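(* Let $0\le\beta<1$. The sharp (smallest possible) constant $K_2(\beta)$ in the inequality $$\|u\|_\infty^2\le K_2(\beta)\left(\int_0^{2\pi}\bigl(u'(x)^2-\beta u(x)^2\bigr)dx\right)^{1/2}\left(\int_0^{2\pi}u(x)^2dx\right)^{1/2}\quad\text{for all }u\in\dot H^1(0,2\pi)_{\mathrm{per}}$$ is given by $$K_2(\beta)=\sup_{\lambda>0}\sqrt{\lambda}\,\frac{\sqrt{\lambda-\beta}\,\coth(\pi\sqrt{\lambda-\beta})-1/\pi}{\lambda-\beta}.$$ Furthermore, $K_2(\beta)=1$ for all $0\le \beta\le\beta_{**}$, where $\beta_{**}=0.839\dots$.
   Context: $\dot H^1(0,2\pi)_{\mathrm{per}}$ is the space of real-valued $2\pi$-periodic $H^1$ functions $u$ with $\int_0^{2\pi}u(x)\,dx=0$; $\|u\|_\infty$ is the sup norm. For $\lambda<\beta$ the expression $\sqrt{\lambda-\beta}\coth(\pi\sqrt{\lambda-\beta})$ is understood by analytic continuation, i.e. as $\sqrt{\beta-\lambda}\cot(\pi\sqrt{\beta-\lambda})$, and at $\lambda=\beta$ the quotient is understood as its limit (equivalently, the quotient equals $\frac1\pi\sum_{k\in\mathbb{Z}\setminus\{0\}}\frac1{k^2-\beta+\lambda}$). $\beta_{**}$ denotes the threshold value, i.e. the largest $\beta\in[0,1)$ for which the supremum equals $1$; it was found numerically. *)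

(* Defs.v *)
From HB Require Import structures.
From mathcomp Require Import all_boot all_order all_algebra.
From mathcomp Require Import all_classical all_reals all_analysis.

Set Implicit Arguments.
Unset Strict Implicit.
Unset Printing Implicit Defensive.

Import Order.TTheory GRing.Theory Num.Theory.
Import numFieldNormedType.Exports.

Local Open Scope classical_set_scope.
Local Open Scope ring_scope.

Section sobolev.
Context {R : realType}.
Local Notation mu := (@lebesgue_measure R).
Implicit Types (u g phi : R -> R) (beta K : R).

Definition period : set R := `[0, 2 * pi].

Definition square_integrable u : Prop :=
  measurable_fun period u /\
  mu.-integrable period (fun x => (u x ^+ 2)%:E).

(* Test functions live on the circle: they are periodic, not compactly
   supported in (0, 2pi), so that a weak derivative in the sense below sees a
   jump across the endpoints. *)
Definition C1_periodic phi : Prop :=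
  [/\ periodic phi (2 * pi),
      forall x, derivable phi x 1
    & continuous (phi^`()%classic : R -> R)].

Definition weak_derivative u g : Prop :=
  forall phi, C1_periodic phi ->
    \int[mu]_(x in period) (u x * phi^`()%classic x) =
    - \int[mu]_(x in period) (g x * phi x).

(* [H1dot_per u g] : u is in the space \dot H^1(0, 2pi)_per and g is (a
   representative of) u'. No continuity is required of u: like g, it is an
   arbitrary measurable representative of its class. *)
Definition H1dot_per u g : Prop :=
  [/\ periodic u (2 * pi),
      square_integrable u,
      square_integrable g,
      weak_derivative u g
    & \int[mu]_(x in period) u x = 0].

(* The L^oo norm is taken over the whole line; by periodicity this is the
   norm over one period. *)
Definition interpolation_inequality beta K : Prop :=
  forall u g, H1dot_per u g ->
    ('N[mu]_+oo[EFin \o u] ^+ 2 <=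
     (K * Num.sqrt (\int[mu]_(x in period) (g x ^+ 2 - beta * u x ^+ 2))
        * Num.sqrt (\int[mu]_(x in period) (u x ^+ 2)))%:E)%E.

Definition sharp_constant beta K : Prop :=
  interpolation_inequality beta K /\
  lbound [set K' | interpolation_inequality beta K'] K.

End sobolev.

Section supremum.
Context {R : realType}.
Implicit Types (x s beta lambda : R).

Definition coth x : R := (expR x + expR (- x)) / (expR x - expR (- x)).

Definition cot x : R := cos x / sin x.

(* sqrt s * coth (pi * sqrt s), continued analytically to s < 0. *)
Definition sqrt_coth s : R :=
  if 0 < s then Num.sqrt s * coth (pi * Num.sqrt s)
  else Num.sqrt (- s) * cot (pi * Num.sqrt (- s)).

Definition quotient0 s : R := (sqrt_coth s - pi^-1) / s.

(* The singularity at 0 is removable from both sides: the limit is pi / 3. *)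
Definition quotient s : R :=
  if s == 0 then lim (quotient0 @ 0^') else quotient0 s.

Definition sup_values beta : set R :=
  [set Num.sqrt lambda * quotient (lambda - beta)
     | lambda in [set lambda | 0 < lambda]].

(* sup is the real-valued one, equal to 0 on sets that are not bounded above;
   requiring it to be 1 therefore also forces boundedness. *)
Definition threshold : set R :=
  [set beta | 0 <= beta < 1 /\ sup (sup_values beta) = 1].

End supremum.

(* Main.v *)
(* Expand u in a Fourier series. With s = lambda - beta, Cauchy-Schwarz with
   the weights k^2 + s bounds u(x)^2 by
   (1/pi) F(s) (int (u'^2 - beta u^2) + lambda int u^2), F(s) = sum_{k >= 1} 1 / (k^2 + s),
   and the choice lambda = int (u'^2 - beta u^2) / int u^2 turns this into the
   interpolation inequality with constant sup_lambda sqrt lambda (2 / pi) F(s).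
   The partial sums of the Green function sum_k cos(k x) / (k^2 + s) show that
   no smaller constant works, and the Fourier series of cosh (sqrt s (pi - x))
   (of cos (sqrt (-s) (pi - x)) for s < 0) at x = 0 identifies (2 / pi) F(s) with the
   quotient.  Since F decreases and (1 + s) F(s) increases with s, the threshold set is
   a closed interval; its end point is located with telescoping rational
   bounds for the tails of F, which also give the needed bounds on pi. *)
Require Import Defs.
From mathcomp Require Import all_boot all_order all_algebra.
From mathcomp Require Import all_classical all_reals all_analysis.
From mathcomp Require Import measurable_realfun ess_sup_inf ring lra.

Set Implicit Arguments.
Unset Strict Implicit.
Unset Printing Implicit Defensive.

Import Order.TTheory GRing.Theory Num.Theory.
Import numFieldNormedType.Exports.

Local Open Scope classical_set_scope.
Local Open Scope ring_scope.

(** * Integration over one period *)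

Section period_integral.
Context {R : realType}.
Local Notation mu := (@lebesgue_measure R).
Local Notation P := (@period R).
Implicit Types (f g h u : R -> R) (c : R).

(** The obstacle is that [u] is only a measurable representative with a weak derivative, so its
    Fourier expansion has to be earned. Testing the weak derivative against waves gives the
    coefficients of [u']; Bessel and AM-GM then make those of [u] absolutely summable, so the series
    converges uniformly to a continuous function. That it equals [u] almost everywhere is
    completeness of the trigonometric system: at points of continuity by a concentrating kernel, for
    integrable functions by passing to the primitive. The same completeness yields the Fourier
    series behind the quotient. Since [s = lambda - beta] may be negative, the energy with weights
    [k^2 + s] needs Parseval for [u], whereas Bessel suffices for [u']. The numerical part turns on
    [s = -1/4]: there [1 / (k^2 + s)] telescopes exactly, with tail [1 / (N + 1/2)], and
    monotonicity in [s] makes this tail an upper bound on one side and a lower bound on the other;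
    the refined [tail] covers the opposite directions. For large [lambda], where the gap to 1 is of
    order [1 / sqrt lambda], the closed form with coth replaces the series. *)

Definition pintegrable f := mu.-integrable P (EFin \o f).

Local Notation "''I' f" := (\int[mu]_(x in P) f x) (at level 10, f at level 9).

Lemma twopi_gt0 : 0 < 2 * pi :> R.
Proof. by rewrite mulr_gt0// pi_gt0. Qed.

Lemma pi_neq0 : pi != 0 :> R.
Proof. by rewrite gt_eqF// pi_gt0. Qed.

Lemma measurable_period : measurable (P : set (measurableTypeR R)).
Proof. exact: measurable_itv. Qed.
Hint Resolve measurable_period : core.

Lemma mu_period : mu (P : set (measurableTypeR R)) = (2 * pi)%:E.
Proof. by rewrite lebesgue_measure_itv/= lte_fin twopi_gt0 oppr0 addr0. Qed.

Lemma pintegrable_within f : {within P, continuous f} -> pintegrable f.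
Proof. by move=> cf; apply: continuous_compact_integrable => //; exact: segment_compact. Qed.

Lemma pintegrable_continuous f : continuous f -> pintegrable f.
Proof. by move=> cf; apply: pintegrable_within; exact: continuous_subspaceT. Qed.

Lemma pintegrable_eq f g : {in P, f =1 g} -> pintegrable f -> pintegrable g.
Proof. by move=> fg; apply: eq_integrable => // x /fg /= ->. Qed.

Lemma pintegrableD f g : pintegrable f -> pintegrable g -> pintegrable (fun x => f x + g x).
Proof. by move=> fi gi; have := integrableD measurable_period fi gi; apply: eq_integrable. Qed.

Lemma pintegrableZ c f : pintegrable f -> pintegrable (fun x => c * f x).
Proof. by move=> fi; have := integrableZl measurable_period c fi; apply: eq_integrable. Qed.

Lemma pintegrableN f : pintegrable f -> pintegrable (fun x => - f x).
Proof. by move=> fi; apply: pintegrable_eq (pintegrableZ (-1) fi) => x _; rewrite mulN1r. Qed.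

Lemma pintegrableB f g : pintegrable f -> pintegrable g -> pintegrable (fun x => f x - g x).
Proof. by move=> fi gi; apply: pintegrableD => //; exact: pintegrableN. Qed.

Lemma pintegrable_sum N (f : nat -> R -> R) : (forall k, pintegrable (f k)) ->
  pintegrable (fun x => \sum_(k < N) f k x).
Proof.
move=> fi; have := @integrable_sum _ _ _ mu P measurable_period 'I_N (index_enum _) xpredT
  (fun k => EFin \o f k) (fun i _ => fi i).
by apply: eq_integrable => // x _; rewrite /= sumEFin.
Qed.

Lemma pintegrable_cst c : pintegrable (cst c).
Proof. by apply: pintegrable_continuous; exact: cst_continuous. Qed.

Lemma bounded_continuous_period h : continuous h ->
  exists M : R, forall x, P x -> `|h x| <= M.
Proof.
move=> ch; have /compact_bounded[M [_ Mh]] : compact (h @` P).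
  by apply: continuous_compact; [exact: continuous_subspaceT|exact: segment_compact].
by exists (M + 1) => x Px; apply: Mh; rewrite ?ltrDl//; exists x.
Qed.

Lemma pintegrableM f h : pintegrable f -> continuous h -> pintegrable (fun x => f x * h x).
Proof.
move=> fi ch; have [M Mh] := bounded_continuous_period ch.
have := @integrableMl _ _ _ mu P measurable_period (EFin \o f) h fi.
have mh : measurable_fun P h.
  by apply: measurable_funTS; exact: continuous_measurable_fun.
move=> /(_ mh); have bh : [bounded h x | x in P].
  by exists M; split; [rewrite num_real|move=> N /ltW MN x /Mh /le_trans; exact].
by move=> /(_ bh); apply: eq_integrable.
Qed.

Lemma pintegrable_norm f : pintegrable f -> pintegrable (fun x => `|f x|).
Proof. exact: integrable_norm. Qed.

Lemma pintegralZ c f : pintegrable f -> 'I (fun x => c * f x) = c * 'I f.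
Proof. exact: RintegralZl. Qed.

Lemma pintegralD f g : pintegrable f -> pintegrable g -> 'I (fun x => f x + g x) = 'I f + 'I g.
Proof. exact: RintegralD. Qed.

Lemma pintegralB f g : pintegrable f -> pintegrable g -> 'I (fun x => f x - g x) = 'I f - 'I g.
Proof. exact: RintegralB. Qed.

Lemma eq_pintegral f g : (forall x, P x -> f x = g x) -> 'I f = 'I g.
Proof. by move=> fg; apply: eq_Rintegral => x /set_mem; exact: fg. Qed.

Lemma le_pintegral f g : pintegrable f -> pintegrable g -> (forall x, P x -> f x <= g x) -> 'I f <= 'I g.
Proof. exact: le_Rintegral. Qed.

Lemma pintegral_cst c : 'I (cst c) = 2 * pi * c.
Proof.
transitivity (c * fine (mu P)); last by rewrite mu_period mulrC.
exact: Rintegral_cst.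
Qed.

Lemma pintegral_sum N (f : nat -> R -> R) : (forall k, pintegrable (f k)) ->
  'I (fun x => \sum_(k < N) f k x) = \sum_(k < N) 'I (f k).
Proof.
move=> fi; elim: N => [|N IH].
  under eq_Rintegral do rewrite big_ord0.
  by rewrite big_ord0 (pintegral_cst 0) mulr0.
under eq_Rintegral do rewrite big_ord_recr/=.
by rewrite pintegralD ?IH ?big_ord_recr//; exact: pintegrable_sum.
Qed.

Lemma ler_norm_pintegral f : pintegrable f -> `|'I f| <= 'I (fun x => `|f x|).
Proof. exact: le_normr_Rintegral. Qed.

(** On a set of finite measure [|u| <= 1 + u^2] is an integrable majorant. *)
Lemma pintegrable_of_square u : square_integrable u -> pintegrable u.
Proof.
move=> [mu_ u2]; have i2 : pintegrable (fun x => 1 + u x ^+ 2) by apply: pintegrableD => //; exact: (pintegrable_cst 1).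
apply: (le_integrable measurable_period _ _ i2); first exact/measurable_EFinP.
move=> x _ /=; rewrite lee_fin [leRHS]ger0_norm; last by rewrite addr_ge0// sqr_ge0.
by rewrite -real_normK ?num_real//; have := sqr_ge0 (`|u x| - 1); have := normr_ge0 (u x); nra.
Qed.

Lemma square_integrable_continuous h : continuous h -> square_integrable h.
Proof.
move=> ch; split; first by apply: measurable_funTS; exact: continuous_measurable_fun.
by apply: (@pintegrable_continuous (fun x => h x ^+ 2)) => x; apply: cvgM; exact: ch.
Qed.

Lemma pintegral_FTC2 f (F : R -> R) : continuous f -> (forall x : R, is_derive x 1 F (f x)) ->
  'I f = F (2 * pi) - F 0.
Proof.
move=> cf dF; rewrite /Rintegral (@continuous_FTC2 _ f F)//.
- exact: twopi_gt0.
- exact: continuous_subspaceT.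
- have cF : continuous F by move=> x; apply: differentiable_continuous; apply/derivable1_diffP; apply: ex_derive.
  split; first by move=> x _; exact: ex_derive.
  + by apply: cvg_at_right_filter; exact: cF.
  + by apply: cvg_at_left_filter; exact: cF.
- by move=> x _; rewrite derive1E; exact: derive_val.
Qed.

End period_integral.

(** * The trigonometric system: orthogonality and Bessel's inequality *)

Section trigonometric_system.
Context {R : realType}.
Local Notation mu := (@lebesgue_measure R).
Local Notation P := (@period R).
Implicit Types (f g h u : R -> R) (c th : R) (k j N : nat).

Local Notation "''I' f" := (\int[mu]_(x in P) f x) (at level 10, f at level 9).

(** The phase merges cosine ([th = 0]) and sine ([th = - pi / 2]) into one family, in which
    differentiation is a phase shift by [pi / 2]. *)
Definition wave (k : nat) (th : R) (x : R) : R := cos (k%:R * x + th).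

Lemma is_derive_wave k th (x : R) :
  is_derive x 1 (wave k th) (- (k%:R * sin (k%:R * x + th))).
Proof.
have : is_derive x 1 (cos \o (fun z : R => k%:R * z + th)) (- sin (k%:R * x + th) *: k%:R).
  apply: is_derive1_comp; apply: is_derive_eq; rewrite /GRing.scale/=; ring.
by move=> H; apply: (@is_derive_eq _ _ _ _ _ _ _ _ H); rewrite /GRing.scale/=; ring.
Qed.

Lemma sin_wave k (x : R) : sin (k%:R * x) = wave k (- (pi / 2)) x.
Proof. by rewrite /wave cosBpihalf. Qed.

Lemma cos_wave k (x : R) : cos (k%:R * x) = wave k 0 x.
Proof. by rewrite /wave addr0. Qed.

Lemma derive_wave k th :
  (wave k th)^`()%classic = (fun x => k%:R * wave k (th + pi / 2) x).
Proof.
apply/funext => x; rewrite derive1E (@derive_val _ _ _ _ _ _ _ (is_derive_wave k th x)).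
by rewrite /wave addrA cosDpihalf mulrN.
Qed.

Lemma continuous_wave k th : continuous (wave k th).
Proof.
move=> x; apply: differentiable_continuous; apply/derivable1_diffP.
by apply: ex_derive; exact: is_derive_wave.
Qed.

Lemma cosD2piMn (x : R) k : cos (x + k%:R * (2 * pi)) = cos x.
Proof.
elim: k x => [|k IH] x; first by rewrite mul0r addr0.
rewrite -natr1 mulrDl mul1r addrA -[RHS]IH.
by rewrite -[RHS]cosD2pi; congr (cos (_ + _)); rewrite mulr_natl.
Qed.

Lemma periodic_wave k th : periodic (wave k th) (2 * pi).
Proof. by move=> x; rewrite /wave mulrDr addrAC cosD2piMn. Qed.

Lemma wave_norm k th x : `|wave k th x| <= 1.
Proof. by rewrite ler_norml cos_geN1 cos_le1. Qed.

Lemma is_derive_wave_primitive k th (x : R) : (0 < k)%N ->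
  is_derive x 1 (fun x => k%:R^-1 * wave k (th - pi / 2) x) (wave k th x).
Proof.
move=> k0; have k0' : k%:R != 0 :> R by rewrite pnatr_eq0 -lt0n.
have H := is_deriveZ k%:R^-1 (is_derive_wave k (th - pi / 2) x).
apply: (@is_derive_eq _ _ _ _ _ _ _ _ H).
by rewrite /GRing.scale/= /wave addrA sinBpihalf mulrN mulKf ?opprK.
Qed.

Lemma pintegral_wave k th : (0 < k)%N -> 'I (wave k th) = 0.
Proof.
move=> k0; pose F x := k%:R^-1 * wave k (th - pi / 2) x.
transitivity (F (2 * pi) - F 0).
  apply: pintegral_FTC2; first exact: continuous_wave.
  by move=> x; exact: is_derive_wave_primitive.
by rewrite /F -[2 * pi]add0r periodic_wave subrr.
Qed.

Lemma wave0 th : wave 0 th = cst (cos th).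
Proof. by apply/funext => x; rewrite /wave mul0r add0r. Qed.

(** Product-to-sum formula; [j <= k] keeps the difference of frequencies a natural number. *)
Lemma waveM k j th ps x : (j <= k)%N ->
  wave k th x * wave j ps x =
  2^-1 * (wave (k + j) (th + ps) x + wave (k - j) (th - ps) x).
Proof.
move=> jk; rewrite /wave natrD natrB//.
have -> : (k%:R + j%:R) * x + (th + ps) = (k%:R * x + th) + (j%:R * x + ps) by ring.
have -> : (k%:R - j%:R) * x + (th - ps) = (k%:R * x + th) - (j%:R * x + ps) by ring.
by move: (_ + th) (_ + ps) => A B; rewrite cosD cosB; field.
Qed.

Lemma pintegrable_wave k th : pintegrable (wave k th).
Proof. exact/pintegrable_continuous/continuous_wave. Qed.

Lemma pintegral_waveM k j th ps : (0 < k)%N -> (0 < j)%N ->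
  'I (fun x => wave k th x * wave j ps x) = if k == j then pi * cos (th - ps) else 0.
Proof.
wlog jk : k j th ps / (j <= k)%N => [H k0 j0|k0 j0].
  have /orP[jk|kj] := leq_total j k; first exact: H.
  under eq_Rintegral do rewrite mulrC.
  by rewrite H// eq_sym -cosN opprB.
under eq_Rintegral do rewrite waveM//.
rewrite pintegralZ; last by apply: pintegrableD; exact: pintegrable_wave.
rewrite pintegralD; [|exact: pintegrable_wave..].
rewrite pintegral_wave ?addn_gt0 ?k0// add0r; case: eqVneq => [->|kj].
  by rewrite subnn wave0 pintegral_cst; field.
by rewrite pintegral_wave ?mulr0// subn_gt0 ltn_neqAle jk eq_sym kj.
Qed.

(** Entry [k] of a coefficient sequence belongs to frequency [k + 1]: there is no constant term, in
    accordance with zero mean. The coefficients [cosc] and [sinc] use the same shift and carry no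
    factor [1 / pi]. *)
Definition trig_sum (a b : nat -> R) N x :=
  \sum_(k < N) (a k * wave k.+1 0 x + b k * wave k.+1 (- (pi / 2)) x).

Definition cosc f k := 'I (fun x => f x * wave k.+1 0 x).
Definition sinc f k := 'I (fun x => f x * wave k.+1 (- (pi / 2)) x).

Lemma continuous_trig_sum a b N : continuous (trig_sum a b N).
Proof.
elim: N => [|N IH] x.
  rewrite (_ : trig_sum _ _ _ = cst 0); first exact: cst_continuous.
  by apply/funext => y; rewrite /trig_sum big_ord0.
rewrite (_ : trig_sum _ _ _ = (fun x => trig_sum a b N x +
   (a N * wave N.+1 0 x + b N * wave N.+1 (- (pi / 2)) x))).
  apply: cvgD; first exact: IH.
  by apply: cvgD; apply: cvgM; first [exact: cvg_cst|exact: continuous_wave].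
by apply/funext => y; rewrite /trig_sum big_ord_recr.
Qed.

Lemma periodic_trig_sum a b N : periodic (trig_sum a b N) (2 * pi).
Proof. by move=> x; apply: eq_bigr => k _; rewrite !periodic_wave. Qed.

Lemma pintegral_mul_trig_sum f a b N : pintegrable f ->
  'I (fun x => f x * trig_sum a b N x) = \sum_(k < N) (a k * cosc f k + b k * sinc f k).
Proof.
move=> fi; under eq_Rintegral do rewrite /trig_sum mulr_sumr.
have ic k th : pintegrable (fun x => f x * wave k th x) by apply: pintegrableM => //; exact: continuous_wave.
rewrite (@pintegral_sum _ _ (fun k x => f x * (a k * wave k.+1 0 x + b k * wave k.+1 (- (pi / 2)) x))).
  apply: eq_bigr => k _; rewrite -pintegralZ// -pintegralZ// -pintegralD; [|exact: pintegrableZ..].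
  by apply: eq_pintegral => x _; ring.
move=> k; apply: pintegrable_eq (pintegrableD (pintegrableZ (a k) (ic k.+1 0)) (pintegrableZ (b k) (ic k.+1 (- (pi/2))))).
by move=> x _; ring.
Qed.

Lemma pintegrable_trig_sum a b N : pintegrable (trig_sum a b N).
Proof. exact/pintegrable_continuous/continuous_trig_sum. Qed.

Lemma pintegral_wave_trig_sum a b N j th :
  'I (fun x => wave j.+1 th x * trig_sum a b N x) =
  if (j < N)%N then pi * (a j * cos th + b j * - sin th) else 0.
Proof.
rewrite pintegral_mul_trig_sum ?pintegrable_wave//; transitivity
  (\sum_(k < N) if j == k :> nat then pi * (a k * cos th + b k * - sin th) else 0).
  apply: eq_bigr => k _; rewrite /cosc /sinc !pintegral_waveM// eqSS.
  by case: ifP => _; rewrite ?mulr0 ?addr0// subr0 opprK cosDpihalf; ring.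
rewrite -big_mkcond/=; case: ifPn => [jN|]; first by rewrite (big_pred1 (Ordinal jN))// => i; rewrite -val_eqE eq_sym.
rewrite -leqNgt => Nj; rewrite big1// => i /eqP ji.
by have := ltn_ord i; rewrite -ji ltnNge Nj.
Qed.

Lemma cosc_trig_sum a b N j : cosc (trig_sum a b N) j = if (j < N)%N then pi * a j else 0.
Proof.
rewrite /cosc; under eq_Rintegral do rewrite mulrC.
by rewrite pintegral_wave_trig_sum cos0 sin0 oppr0 mulr1 mulr0 addr0.
Qed.

Lemma sinc_trig_sum a b N j : sinc (trig_sum a b N) j = if (j < N)%N then pi * b j else 0.
Proof.
rewrite /sinc; under eq_Rintegral do rewrite mulrC.
by rewrite pintegral_wave_trig_sum cosN sinN cos_pihalf sin_pihalf opprK mulr1 mulr0 add0r.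
Qed.

Lemma pintegral_trig_sum a b N : 'I (trig_sum a b N) = 0.
Proof.
have := @pintegral_mul_trig_sum (cst 1) a b N (pintegrable_cst 1).
under eq_Rintegral do rewrite mul1r.
move=> ->; rewrite big1// => k _; rewrite /cosc /sinc.
under eq_Rintegral do rewrite mul1r.
under [X in _ + _ * X]eq_Rintegral do rewrite mul1r.
by rewrite !pintegral_wave// !mulr0 addr0.
Qed.

Lemma pintegral_trig_sumM a b a' b' N :
  'I (fun x => trig_sum a b N x * trig_sum a' b' N x) =
  pi * \sum_(k < N) (a k * a' k + b k * b' k).
Proof.
rewrite pintegral_mul_trig_sum ?pintegrable_trig_sum// mulr_sumr; apply: eq_bigr => k _.
by rewrite cosc_trig_sum sinc_trig_sum ltn_ord; ring.
Qed.

(** With [s] the Fourier partial sum, the integrals of [f * s] and of [s^2] both equal the left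
    side, so the claim is that the integral of [(f - s)^2] is nonnegative. *)
Lemma bessel f N : square_integrable f ->
  pi^-1 * \sum_(k < N) (cosc f k ^+ 2 + sinc f k ^+ 2) <= 'I (fun x => f x ^+ 2).
Proof.
move=> f2; have fi := pintegrable_of_square f2.
pose s := trig_sum (fun k => pi^-1 * cosc f k) (fun k => pi^-1 * sinc f k) N.
have sc : continuous s by exact: continuous_trig_sum.
have s2 : 'I (fun x => s x ^+ 2) = pi^-1 * \sum_(k < N) (cosc f k ^+ 2 + sinc f k ^+ 2).
  under eq_Rintegral do rewrite expr2.
  rewrite pintegral_trig_sumM !mulr_sumr; apply: eq_bigr => k _.
  have := @pi_neq0 R; move: (pi : R) (cosc f k) (sinc f k) => p a b p0.
  by field.
have fs : 'I (fun x => f x * s x) = pi^-1 * \sum_(k < N) (cosc f k ^+ 2 + sinc f k ^+ 2).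
  by rewrite pintegral_mul_trig_sum// mulr_sumr; apply: eq_bigr => k _; ring.
have : 0 <= 'I (fun x => (f x - s x) ^+ 2) by apply: Rintegral_ge0 => x _; exact: sqr_ge0.
have -> : 'I (fun x => (f x - s x) ^+ 2) =
   'I (fun x => f x ^+ 2) - 2 * 'I (fun x => f x * s x) + 'I (fun x => s x ^+ 2).
  have [_ is2] := square_integrable_continuous sc.
  have ifs : pintegrable (fun x => f x * s x) by exact: pintegrableM.
  rewrite -pintegralZ// -pintegralB; [|exact: f2.2|exact: pintegrableZ].
  rewrite -pintegralD; [|by apply: pintegrableB; [exact: f2.2|exact: pintegrableZ]|exact: is2].
  by apply: eq_pintegral => x _; ring.
by rewrite s2 fs; lra.
Qed.

End trigonometric_system.

(** * Completeness at points of continuity *)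

Section completeness.
Context {R : realType}.
Local Notation mu := (@lebesgue_measure R).
Local Notation P := (@period R).
Implicit Types (f g h u w : R -> R) (c th : R) (k j N : nat).

Local Notation "''I' f" := (\int[mu]_(x in P) f x) (at level 10, f at level 9).

(** Here [k] is the frequency itself; [k = 0] makes the mean of [f] vanish. *)
Definition orth f := pintegrable f /\ forall k th, 'I (fun x => f x * wave k th x) = 0.

Lemma continuous_bump c x0 : continuous (fun x : R => c + cos (x - x0)).
Proof.
move=> x; apply: cvgD; first exact: cvg_cst.
apply: (@continuous_comp _ _ _ (fun x => x - x0) cos); last exact: continuous_cos.
by apply: cvgB; [exact: cvg_id|exact: cvg_cst].
Qed.

(* Multiplication by [cos (x - x0)] shifts frequencies by one, so
   orthogonality to all frequencies is preserved. *)
Lemma orthM f c x0 : orth f -> orth (fun x => f x * (c + cos (x - x0))).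
Proof.
move=> [fi fo]; split; first by apply: pintegrableM => //; exact: continuous_bump.
move=> k th; have ifw j ps : pintegrable (fun x => f x * wave j ps x).
  by apply: pintegrableM => //; exact: continuous_wave.
have [j [ps Hw]] : exists j ps, forall x, cos (x - x0) * wave k th x =
    2^-1 * (wave k.+1 (th - x0) x + wave j ps x).
  case: k => [|k].
    exists 1%N, (- x0 - th) => x; rewrite -[x in cos (x - _)]mul1r.
    rewrite -[cos _]/(wave 1 (- x0) x) waveM//.
    by rewrite addn0 subn0 [- x0 + th]addrC.
  exists k, (th + x0) => x; rewrite mulrC -[x in cos (x - _)]mul1r.
  by rewrite -[cos _]/(wave 1 (- x0) x) waveM// addn1 subn1 opprK.
transitivity ('I (fun x => c * (f x * wave k th x) + 2^-1 *
   (f x * wave k.+1 (th - x0) x + f x * wave j ps x))).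
  apply: eq_pintegral => x _; rewrite mulrDr mulrDl -[f x * cos _ * _]mulrA Hw; ring.
rewrite pintegralD; [|exact: pintegrableZ|by apply: pintegrableZ; exact: pintegrableD].
by rewrite !pintegralZ ?pintegralD ?fo ?addr0 ?mulr0 ?addr0//; exact: pintegrableD.
Qed.

Lemma orth_bump f c x0 n : orth f -> orth (fun x => f x * (c + cos (x - x0)) ^+ n).
Proof.
elim: n f => [|n IH] f fo.
  by rewrite (_ : (fun x => _) = f)//; apply/funext => x; rewrite expr0 mulr1.
have := IH _ (orthM c x0 fo); congr orth; apply/funext => x.
by rewrite exprS mulrA.
Qed.

Lemma pintegral_orth f : orth f -> 'I f = 0.
Proof.
move=> [fi /(_ 0%N 0)]; rewrite wave0 cos0.
by under eq_Rintegral do rewrite mulr1.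
Qed.

Lemma bernoulli (x : R) n : 0 <= x -> 1 + n%:R * x <= (1 + x) ^+ n.
Proof.
move=> x0; elim: n => [|n IH]; first by rewrite mul0r addr0 expr0.
rewrite exprS; apply: (@le_trans _ _ ((1 + x) * (1 + n%:R * x))).
  by rewrite -natr1; have : 0 <= n%:R :> R by []; nra.
by rewrite ler_wpM2l// addr_ge0.
Qed.

(** Beyond [pi] the reflection [y -> 2 pi - y] leads back to [[0, pi]], where cosine decreases. *)
Lemma cos_le_far (d y : R) : 0 <= d <= pi -> d <= `|y| <= 2 * pi - d -> cos y <= cos d.
Proof.
move=> /andP[d0 dpi]; rewrite -[cos y]cos_norm.
suff H (z : R) : d <= z <= 2 * pi - d -> cos z <= cos d by exact: H.
move=> {y} /andP[]; move: z => y dy yd.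
have [ypi|ypi] := leP y pi.
  by rewrite -[_ <= _]negbK -ltNge ltr_cos ?in_itv/= ?d0 ?dpi ?ypi ?(le_trans d0)// -leNgt.
have -> : cos y = cos (2 * pi - y).
  by rewrite -[RHS]cosN opprB -[RHS]cosD2pi; congr cos; rewrite -mulr_natl; ring.
have ? : 0 <= 2 * pi - y by lra.
have ? : 2 * pi - y <= pi by lra.
rewrite -[_ <= _]negbK -ltNge ltr_cos ?in_itv/= ?d0 ?dpi ?andbT//; last by apply/andP.
by rewrite -leNgt; lra.
Qed.

(* The powers of [1 - cos d + cos (x - x0)] blow up near [x0] and are bounded
   by 1 at distance at least [d] from it. *)
Lemma orth_not_gt0 f (x0 : R) : orth f -> 0 < x0 < 2 * pi -> {for x0, continuous f} -> ~ 0 < f x0.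
Proof.
move=> fo /andP[x00 x0p] cf f0.
have [d [d0 dpi dx dx' fd]] : exists d : R, [/\ 0 < d, d <= pi, d <= x0, x0 + d <= 2 * pi &
    forall x, `|x - x0| <= d -> f x0 / 2 <= f x].
  have /cvgrPdist_lt/(_ (f x0 / 2)) := cf; rewrite divr_gt0// => /(_ isT)[e /= e0 He].
  exists (Num.min (e / 2) (Num.min pi (Num.min x0 (2 * pi - x0)))).
  set m := Num.min _ _.
  have [m1 m2 m3 m4] : [/\ m <= e / 2, m <= pi, m <= x0 & m <= 2 * pi - x0].
    by rewrite /m; split; rewrite !ge_min lexx ?orbT.
  split => //.
  - by rewrite /m !lt_min pi_gt0 x00 divr_gt0//= subr_gt0.
  - by rewrite -lerBrDl.
  - move=> x xm; have /He : ball x0 e x.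
      by rewrite /ball/= distrC (le_lt_trans xm)// (le_lt_trans m1)//; lra.
    by rewrite /= ltr_distl => /andP[_]; lra.
pose T x : R := 1 - cos d + cos (x - x0).
pose eta : R := cos (d / 2) - cos d.
have eta0 : 0 < eta.
  rewrite subr_gt0 ltr_cos ?in_itv/= ?(ltW d0) ?dpi//; first by lra.
  by apply/andP; split; lra.
pose J : set R := `[x0 - d / 2, x0 + d / 2]%classic.
pose chi : R -> R := \1_J.
have ichi : pintegrable chi.
  have := @integrable_indic_itv R (x0 - d / 2) (x0 + d / 2) true false.
  by apply: integrableS => //; exact: measurable_period.
have Ichi : 'I chi = d.
  have JP : J `<=` P.
    move=> x; rewrite /J/period/= !in_itv/= => /andP[? ?].
    by apply/andP; split; lra.
  rewrite /Rintegral integral_indic; [|exact: measurable_period|exact: measurable_itv].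
  rewrite setIidl// [X in fine X](_ : _ = d%:E)//.
  apply: (etrans (lebesgue_measure_itv `[x0 - d / 2, x0 + d / 2])).
  rewrite /= lte_fin ifT; last by lra.
  by rewrite -EFinB; congr EFin; lra.
have [fi _] := fo.
pose C := 'I (fun x => `|f x|).
(* Pointwise, [f T^n] is at least [f x0 / 2 * (1 + n eta) * chi - |f|], while its integral vanishes
   by orthogonality. The resulting bound is uniform in [n], which is absurd since [eta], [d] and
   [f x0] are positive. *)
have key n : f x0 / 2 * (1 + n%:R * eta) * d <= C.
  have := pintegral_orth (orth_bump (1 - cos d) x0 n fo) => I0.
  rewrite -subr_le0; suff : f x0 / 2 * (1 + n%:R * eta) * 'I chi - C <=
      'I (fun x => f x * (1 - cos d + cos (x - x0)) ^+ n) by rewrite Ichi I0.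
  rewrite -pintegralZ// -pintegralB; [|exact: pintegrableZ|exact: pintegrable_norm].
  have [io _] := orth_bump (1 - cos d) x0 n fo.
  apply: le_pintegral => //; first by apply: pintegrableB; [exact: pintegrableZ|exact: pintegrable_norm].
  move=> x Px; rewrite -/(T x).
  have [far|near] := ltP d `|x - x0|.
    have -> : chi x = 0.
      rewrite /chi indicE memNset// /J/= in_itv/= => /andP[? ?].
      by move: far; rewrite ltr_normr => /orP[]; lra.
    rewrite mulr0 sub0r; have T1 : `|T x ^+ n| <= 1.
      rewrite normrX exprn_ile1// ler_norml /T.
      have := @cos_le_far d (x - x0) _ _.
      have -> : 0 <= d <= pi by rewrite ltW.
      have -> : d <= `|x - x0| <= 2 * pi - d.
        rewrite ltW//=; move: Px; rewrite /period/= in_itv/= => /andP[? ?].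
        by rewrite ler_norml; apply/andP; split; lra.
      move=> /(_ isT isT); have := cos_le1 d; have := cos_geN1 (x - x0); lra.
    have := ler_norm (- (f x * T x ^+ n)); rewrite normrN normrM.
    have := normr_ge0 (f x); have := normr_ge0 (T x ^+ n); nra.
  have fx := fd x near.
  have fx0 : 0 <= f x by apply: le_trans fx; rewrite divr_ge0// ltW.
  have T1 : 1 <= T x.
    have : cos d <= cos (x - x0); last by rewrite /T; lra.
    rewrite -[cos (x - x0)]cos_norm -[_ <= _]negbK -ltNge ltr_cos ?in_itv/= ?normr_ge0 ?(ltW d0) ?dpi//.
      by rewrite -leNgt.
    exact: le_trans dpi.
  have [xJ|xJ] := boolP (x \in J); last first.
    have -> : chi x = 0 by rewrite /chi indicE (negbTE xJ).
    rewrite mulr0 sub0r; apply: (@le_trans _ _ 0); first by rewrite oppr_le0.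
    by rewrite mulr_ge0// exprn_ge0//; lra.
  have -> : chi x = 1 by rewrite /chi indicE xJ.
  have Te : 1 + eta <= T x.
    have : cos (d / 2) <= cos (x - x0); last by rewrite /T /eta; lra.
    have xd2 : `|x - x0| <= d / 2.
      by move: xJ; rewrite inE /J/= in_itv/= ler_norml => /andP[? ?]; apply/andP; split; lra.
    rewrite -[cos (x - x0)]cos_norm -[_ <= _]negbK -ltNge ltr_cos ?in_itv/= ?normr_ge0//.
    - by rewrite -leNgt.
    - by apply/andP; split; lra.
    - by rewrite (le_trans near).
  have Tn : 1 + n%:R * eta <= T x ^+ n.
    apply: le_trans (bernoulli n (ltW eta0)) _.
    by rewrite lerXn2r// nnegrE; lra.
  have : 0 <= 1 + n%:R * eta by rewrite addr_ge0// mulr_ge0// ltW.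
  have := normr_ge0 (f x); rewrite mulr1 => ? ?; nra.
have {key} : forall n : nat, n%:R <= C / (f x0 / 2 * eta * d).
  have f2 : 0 < f x0 / 2 by rewrite divr_gt0.
  move=> n; rewrite ler_pdivlMr; last by rewrite !mulr_gt0// invr_gt0.
  apply: le_trans (key n); rewrite -subr_ge0.
  rewrite [leRHS](_ : _ = f x0 / 2 * d); last by ring.
  by rewrite mulr_ge0// ltW.
move=> H; set B := C / _ in H.
have := H (Num.truncn `|B|).+1; have := truncnS_gt `|B|; have := ler_norm B; lra.
Qed.

Lemma orthN f : orth f -> orth (fun x => - f x).
Proof.
move=> [fi fo]; split; first exact: pintegrableN.
move=> k th; rewrite -[RHS]oppr0 -(fo k th) -mulN1r -pintegralZ; last by apply: pintegrableM => //; exact: continuous_wave.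
by apply: eq_pintegral => x _; rewrite mulNr mulN1r.
Qed.

Lemma orth_eq0 f (x0 : R) : orth f -> 0 < x0 < 2 * pi -> {for x0, continuous f} -> f x0 = 0.
Proof.
move=> fo x0P cf; apply/eqP/negPn/negP; rewrite neq_lt => /orP[f0|]; last exact: orth_not_gt0.
apply: (orth_not_gt0 (orthN fo) x0P); last by rewrite oppr_gt0.
by apply: cvgN; exact: cf.
Qed.

End completeness.

(** * Primitives and completeness for integrable functions *)

Section primitive.
Context {R : realType}.
Local Notation mu := (@lebesgue_measure R).
Local Notation P := (@period R).
Implicit Types (f g h u w phi dphi : R -> R) (c th e : R) (k j N : nat).

Local Notation "''I' f" := (\int[mu]_(x in P) f x) (at level 10, f at level 9).

Definition primitive f x := parameterized_integral mu 0 x f.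

Lemma integrable_subitv f x : pintegrable f -> P x -> mu.-integrable `[0, x] (EFin \o f).
Proof.
move=> fi Px; apply: integrableS fi => //; first exact: measurable_period.
move=> y; move: Px; rewrite /period/= !in_itv/= => /andP[_ x2] /andP[-> yx].
exact: le_trans yx x2.
Qed.

Lemma pintegrable_primitive f : pintegrable f -> pintegrable (primitive f).
Proof.
move=> fi; apply: pintegrable_within; apply: parameterized_integral_continuous => //.
by rewrite ltW// twopi_gt0.
Qed.

Lemma primitive_norm f x : pintegrable f -> P x -> `|primitive f x| <= 'I (fun x => `|f x|).
Proof.
move=> fi Px; have fx := integrable_subitv fi Px.
rewrite /primitive /parameterized_integral.
apply: le_trans (le_normr_Rintegral _ fx) _; first exact: measurable_itv.
have fin1 := integrable_fin_num _ (pintegrable_norm fi).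
have fin2 := integrable_fin_num _ (integrable_norm fx).
rewrite /Rintegral fine_le ?fin1 ?fin2//.
  exact: measurable_period.
apply: ge0_subset_integral => //.
- exact: measurable_period.
- by have /(measurable_int _) := pintegrable_norm fi.
- move=> y; move: Px; rewrite /period/= !in_itv/= => /andP[_ x2] /andP[-> yx].
  exact: le_trans yx x2.
Qed.

Lemma primitiveB f g x : pintegrable f -> pintegrable g -> P x ->
  primitive (fun x => f x - g x) x = primitive f x - primitive g x.
Proof.
move=> fi gi Px; rewrite /primitive /parameterized_integral RintegralB//.
- exact: integrable_subitv.
- exact: integrable_subitv.
Qed.

Lemma primitive_2pi f : primitive f (2 * pi) = 'I f.
Proof. by []. Qed.

Lemma primitive_0 f : primitive f 0 = 0.
Proof. by rewrite /primitive /parameterized_integral set_itv1 Rintegral_set1. Qed.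

Lemma parts_continuous g phi dphi : continuous g -> continuous dphi ->
  (forall x : R, is_derive x 1 phi (dphi x)) ->
  'I (fun x => primitive g x * dphi x) = 'I g * phi (2 * pi) - 'I (fun x => g x * phi x).
Proof.
move=> cg cd dp; have gi := pintegrable_continuous cg.
have cphi : continuous phi.
  by move=> x; apply: differentiable_continuous; apply/derivable1_diffP; apply: ex_derive.
have cF := parameterized_integral_continuous (ltW (@twopi_gt0 R)) gi.
have ftc x : x \in `]0, 2 * pi[ -> derivable (primitive g) x 1 /\ (primitive g)^`()%classic x = g x.
  rewrite in_itv/= => /andP[x0 x2].
  by apply: (@continuous_FTC1_closed _ g 0 x (2 * pi)) => //; exact: cg.
rewrite (@Rintegration_by_parts _ (primitive g) phi g dphi 0 (2 * pi)).
- by rewrite primitive_0 mul0r subr0 primitive_2pi.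
- exact: twopi_gt0.
- exact: continuous_subspaceT.
- have [_ c0 c2] := (continuous_within_itvP _ (@twopi_gt0 R)).1 cF.
  by split => // x /ftc[].
- by move=> x /ftc[].
- exact: continuous_subspaceT.
- split; first by move=> x _; exact: ex_derive.
  + by apply: cvg_at_right_filter; exact: cphi.
  + by apply: cvg_at_left_filter; exact: cphi.
- by move=> x _; rewrite derive1E; exact: derive_val.
Qed.

Lemma approx_continuous f e : pintegrable f -> 0 < e ->
  exists g, continuous g /\ 'I (fun x => `|f x - g x|) < e.
Proof.
move=> fi e0.
have [||g_ [cg gi]] := @approximation_continuous_integrable R P f _ _ fi.
- exact: measurable_period.
- by apply: (@le_lt_trans _ _ (2 * pi)%:E); rewrite ?ltry// -(@mu_period R).
move=> /fine_cvgP[_ /cvgrPdist_lt/(_ e e0)[n _ /(_ n (leqnn n))]] /= H.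
exists (g_ n); split => //; move: H; rewrite sub0r normrN; apply: le_lt_trans.
exact: ler_norm.
Qed.

(** Both sides are linear in [w] and bounded by its integral norm, so the case of continuous [w]
    extends by density. *)
Lemma parts_integrable w phi dphi : pintegrable w -> continuous dphi ->
  (forall x : R, is_derive x 1 phi (dphi x)) ->
  'I (fun x => primitive w x * dphi x) = 'I w * phi (2 * pi) - 'I (fun x => w x * phi x).
Proof.
move=> wi cd dp.
have cphi : continuous phi.
  by move=> x; apply: differentiable_continuous; apply/derivable1_diffP; apply: ex_derive.
have [M1 HM1] := bounded_continuous_period cphi.
have [M2 HM2] := bounded_continuous_period cd.
have P2 : P (2 * pi) by rewrite /period/= in_itv/= lexx ltW// twopi_gt0.
(* [L] is the defect of the formula: additive, bounded by a multiple of the integral of [|h|], zero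
   on continuous functions. *)
pose L h := 'I (fun x => primitive h x * dphi x) - 'I h * phi (2 * pi) + 'I (fun x => h x * phi x).
suff Lw0 : L w = 0 by apply/eqP; rewrite -subr_eq0 -[X in _ == X]Lw0 /L; apply/eqP; ring.
have LB g : pintegrable g -> L (fun x => w x - g x) = L w - L g.
  move=> gi; rewrite /L pintegralB//.
  have -> : 'I (fun x => primitive (fun x => w x - g x) x * dphi x) =
      'I (fun x => primitive w x * dphi x) - 'I (fun x => primitive g x * dphi x).
    rewrite -pintegralB; [|by apply: pintegrableM => //; exact: pintegrable_primitive..].
    by apply: eq_pintegral => x Px; rewrite primitiveB// mulrBl.
  have -> : 'I (fun x => (w x - g x) * phi x) = 'I (fun x => w x * phi x) - 'I (fun x => g x * phi x).
    rewrite -pintegralB; [|exact: pintegrableM..].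
    by apply: eq_pintegral => x Px; rewrite mulrBl.
  by rewrite mulrBl; move: (Rintegral _ _ _) (_ * phi _) (Rintegral _ _ _) => *; ring.
have Lbound h : pintegrable h -> `|L h| <= (2 * pi * M2 + M1 + M1) * 'I (fun x => `|h x|).
  move=> hi; pose E := 'I (fun x => `|h x|); rewrite -/E.
  have E0 : 0 <= E by apply: Rintegral_ge0.
  have h1 : `|'I (fun x => primitive h x * dphi x)| <= 2 * pi * M2 * E.
    apply: le_trans (ler_norm_pintegral _) _; first by apply: pintegrableM => //; exact: pintegrable_primitive.
    rewrite -mulrA -pintegral_cst; apply: le_pintegral.
    - by apply: pintegrable_norm; apply: pintegrableM => //; exact: pintegrable_primitive.
    - exact: pintegrable_cst.
    - move=> x Px; rewrite normrM mulrC ler_pM//; first exact: HM2.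
      exact: primitive_norm.
  have h2 : `|'I h * phi (2 * pi)| <= M1 * E.
    by rewrite normrM mulrC ler_pM//; [exact: HM1|exact: ler_norm_pintegral].
  have h3 : `|'I (fun x => h x * phi x)| <= M1 * E.
    apply: le_trans (ler_norm_pintegral _) _; first exact: pintegrableM.
    rewrite -pintegralZ; last exact: pintegrable_norm.
    apply: le_pintegral; [by apply: pintegrable_norm; exact: pintegrableM|by apply: pintegrableZ; exact: pintegrable_norm|].
    by move=> x Px; rewrite normrM mulrC ler_wpM2r//; exact: HM1.
  rewrite /L; apply: le_trans (ler_normD _ _) _.
  rewrite (mulrDl _ _ E) (mulrDl _ _ E) lerD// (le_trans (ler_normB _ _))// lerD//.
have M10 : 0 <= M1 by apply: le_trans (HM1 _ P2).
have M20 : 0 <= M2 by apply: le_trans (HM2 _ P2).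
pose M := 2 * pi * M2 + M1 + M1 + 1.
have M0 : 0 < M by rewrite ltr_wpDl// !addr_ge0// mulr_ge0// ltW// twopi_gt0.
apply/eqP/negPn/negP => /eqP/eqP Lw; have Lw0 : 0 < `|L w| / M by rewrite divr_gt0// normr_gt0.
have [g [cg wg]] := approx_continuous wi Lw0.
have gi := pintegrable_continuous cg.
have Lg : L g = 0 by rewrite /L parts_continuous//; ring.
have := Lbound _ (pintegrableB wi gi); rewrite LB// Lg subr0.
move: wg; rewrite ltr_pdivlMr//; rewrite mulrC.
have : 0 <= 'I (fun x => `|w x - g x|) by apply: Rintegral_ge0.
by rewrite /M; move: (2 * pi * M2 + M1 + M1) => K; nra.
Qed.

(** By Lebesgue differentiation the primitive has derivative [f] almost everywhere, and a locally
    constant function has derivative zero. *)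
Lemma primitive_cst_ae f c : pintegrable f -> (forall x : R, 0 < x < 2 * pi -> primitive f x = c) ->
  {ae mu, forall x : R, 0 < x < 2 * pi -> f x = 0}.
Proof.
(* Extension by zero makes [f] integrable on the whole line, as the differentiation theorem is
   applied there. *)
move=> fi Fc; pose fP := f \_ P.
have fPi : mu.-integrable setT (EFin \o fP).
  have [H _] := @integrable_mkcond _ _ _ mu P (EFin \o f) (@measurable_period R).
  have := H fi.
  by rewrite restrict_EFin.
have := @FTC1 R fP (BLeft 0) _ _.
have h1 y : mu.-integrable [set` Interval (BLeft 0) (BRight y)] (EFin \o fP).
  by apply: integrableS fPi.
move=> /(_ h1 (open_integrable_locally openT fPi)).
apply: filterS; first exact: (ae_filter_ringOfSetsType mu).
move=> x /= H /andP[x0 x2].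
have [_] : derivable (primitive fP) x 1 /\ (primitive fP)^`()%classic x = fP x by apply: H; rewrite lte_fin.
have -> : fP x = f x by rewrite /fP patchE mem_set// /period/= in_itv/= !ltW.
move=> <-; rewrite derive1E.
have near_c : \forall y \near x, cst c y = primitive fP y.
  have : x \in `]0, 2 * pi[ by rewrite in_itv/= x0.
  move=> /near_in_itvoo; apply: filterS => y; rewrite in_itv/= => yP.
  rewrite -(Fc y)//; apply: eq_Rintegral => z; rewrite inE/= in_itv/= => /andP[z0 zy].
  rewrite /fP patchE mem_set// /period/= in_itv/= z0/=.
  by case/andP: yP => _ /ltW; exact: le_trans.
by rewrite -(near_eq_derive _ near_c) derive_cst.
Qed.

(* The primitive of [w], shifted by its mean, is continuous and still
   orthogonal to the trigonometric system. *)
Lemma orth_ae0 w : orth w -> {ae mu, forall x : R, 0 < x < 2 * pi -> w x = 0}.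
Proof.
move=> wo; have [wi wk] := wo.
pose c := (2 * pi)^-1 * 'I (primitive w).
apply: (@primitive_cst_ae _ c) => // x x2; apply/eqP; rewrite -subr_eq0; apply/eqP.
pose F x := primitive w x - c.
have Fi : pintegrable F by apply: pintegrableB; [exact: pintegrable_primitive|exact: pintegrable_cst].
apply: (@orth_eq0 _ F) => //; last first.
  have := parameterized_integral_continuous (ltW (@twopi_gt0 R)) wi.
  move=> /(continuous_within_itvP _ (@twopi_gt0 R))[cF _ _].
  by apply: cvgB; [apply: cF; rewrite in_itv/=|exact: cvg_cst].
split => // k th; transitivity ('I (fun x => primitive w x * wave k th x) - c * 'I (wave k th)).
  rewrite -pintegralZ ?pintegrable_wave// -pintegralB; [|by apply: pintegrableM; [exact: pintegrable_primitive|exact: continuous_wave]|exact/pintegrableZ/pintegrable_wave].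
  by apply: eq_pintegral => y _; rewrite mulrBl.
case: k => [|k].
  rewrite wave0 pintegral_cst mulrA; under eq_Rintegral do rewrite /= mulrC.
  rewrite pintegralZ ?pintegrable_primitive//.
  by rewrite [c * _]mulrC mulVKf ?gt_eqF ?twopi_gt0// mulrC subrr.
rewrite pintegral_wave// mulr0 subr0.
rewrite (parts_integrable wi (@continuous_wave R k.+1 th)
  (fun x => @is_derive_wave_primitive R k.+1 th x isT)).
rewrite (pintegral_orth wo) mul0r sub0r.
transitivity (- (k.+1%:R^-1 * 'I (fun x => w x * wave k.+1 (th - pi / 2) x))).
  rewrite -pintegralZ; last by apply: pintegrableM => //; exact: continuous_wave.
  by congr (- _); apply: eq_pintegral => y _; ring.
by rewrite wk mulr0 oppr0.
Qed.

End primitive.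

(** * Absolutely summable Fourier series *)

Section fourier_series.
Context {R : realType}.
Local Notation mu := (@lebesgue_measure R).
Local Notation P := (@period R).
Implicit Types (f g h u w : R -> R) (a b tau : nat -> R) (c th : R) (k j N : nat).

Local Notation "''I' f" := (\int[mu]_(x in P) f x) (at level 10, f at level 9).

Definition trig_series a b (x : R) := limn (fun N => trig_sum a b N x).

Lemma trig_sum_dist a b N M (x : R) : (N <= M)%N ->
  `|trig_sum a b M x - trig_sum a b N x| <=
  series (fun k => `|a k| + `|b k|) M - series (fun k => `|a k| + `|b k|) N.
Proof.
elim: M => [|M IH]; first by rewrite leqn0 => /eqP ->; rewrite !subrr normr0.
rewrite leq_eqVlt => /predU1P[->|]; first by rewrite !subrr normr0.
rewrite ltnS => /IH {}IH.
rewrite /trig_sum big_ord_recr/= -/(trig_sum a b M x) -/(trig_sum a b N x).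
rewrite seriesSr addrAC [leRHS]addrAC (le_trans (ler_normD _ _))// lerD//.
rewrite (le_trans (ler_normD _ _))// !normrM.
by rewrite lerD// ler_piMr// wave_norm.
Qed.

(** Weierstrass test: the rate [tau] is the tail of the coefficient series, the same for all [x]. *)
Lemma trig_series_unif a b : cvgn (series (fun k => `|a k| + `|b k|)) ->
  exists tau, tau @ \oo --> (0 : R) /\
    forall N (x : R), `|trig_series a b x - trig_sum a b N x| <= tau N.
Proof.
set A := series _ => cA; exists (fun N => limn A - A N); split.
  by rewrite -[X in _ --> X](subrr (limn A)); apply: cvgB => //; exact: cvg_cst.
have ndA : nondecreasing_seq A.
  by apply/nondecreasing_seqP => n; rewrite /A seriesSr lerDl addr_ge0.
have dist N M x : (N <= M)%N -> `|trig_sum a b M x - trig_sum a b N x| <= limn A - A N.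
  move=> NM; apply: le_trans (trig_sum_dist a b x NM) _.
  by rewrite lerB// nondecreasing_cvgn_le.
have cx x : cvgn (fun N => trig_sum a b N x).
  pose u k := a k * wave k.+1 0 x + b k * wave k.+1 (- (pi / 2)) x.
  rewrite (_ : (fun N => _) = series u); last first.
    by apply/funext => n; rewrite /series/= big_mkord.
  apply: normed_cvg; apply: series_le_cvg cA => [k|k|k]; first exact: normr_ge0.
    by rewrite addr_ge0.
  rewrite /= (le_trans (ler_normD _ _))// !normrM.
  by rewrite lerD// ler_piMr// wave_norm.
move=> N x.
have H : (fun M => `|trig_sum a b M x - trig_sum a b N x|) @ \oo -->
    `|trig_series a b x - trig_sum a b N x|.
  by apply: cvg_norm; apply: cvgB; [exact: cx|exact: cvg_cst].
by apply: (cvgr_to_le H); exists N => // M /= NM; exact: dist.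
Qed.

Section absolutely_summable.
Variables (a b : nat -> R).
Hypothesis cab : cvgn (series (fun k => `|a k| + `|b k|)).

Lemma continuous_trig_series : continuous (trig_series a b).
Proof.
have [tau [tau0 Htau]] := trig_series_unif cab.
move=> x; apply/cvgrPdist_lt => e e0.
have e3 : 0 < e / 3 by rewrite divr_gt0.
have /cvgrPdist_lt/(_ _ e3)[N _ /(_ N (leqnn N)) tN] := tau0.
move: tN; rewrite /= sub0r normrN => /(le_lt_trans (ler_norm _)) tN.
have /cvgrPdist_lt/(_ _ e3) := @continuous_trig_sum R a b N x.
apply: filterS => y /= xy.
have := Htau N x; have := Htau N y.
rewrite !ler_norml => /andP[? ?] /andP[? ?].
by move: xy; rewrite !ltr_norml => /andP[? ?]; apply/andP; split; lra.
Qed.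

(** The error is at most [tau N] times the integral of [|w|]. *)
Lemma cvg_pintegral_mul_trig_sum w : pintegrable w ->
  (fun N => 'I (fun x => w x * trig_sum a b N x)) @ \oo -->
  'I (fun x => w x * trig_series a b x).
Proof.
move=> wi; have [tau [tau0 Htau]] := trig_series_unif cab.
pose C := 'I (fun x => `|w x|).
have C0 : 0 <= C by apply: Rintegral_ge0.
apply/cvgrPdist_le => e e0.
have eC : 0 < e / (C + 1) by rewrite divr_gt0// ltr_wpDl.
have /cvgrPdist_lt/(_ _ eC) := tau0; apply: filterS => N.
rewrite /= sub0r normrN => /(le_lt_trans (ler_norm _)) tN.
have iN : pintegrable (fun x => w x * trig_sum a b N x) by apply: pintegrableM => //; exact: continuous_trig_sum.
have iS : pintegrable (fun x => w x * trig_series a b x) by apply: pintegrableM => //; exact: continuous_trig_series.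
rewrite -pintegralB//; apply: le_trans (ler_norm_pintegral _) _; first exact: pintegrableB.
apply: (@le_trans _ _ (tau N * C)); last first.
  move: tN; rewrite ltr_pdivlMr ?ltr_wpDl// => /ltW.
  have : 0 <= tau N by apply: le_trans (Htau N 0).
  nra.
rewrite -pintegralZ; last exact: pintegrable_norm.
apply: le_pintegral; [by apply: pintegrable_norm; exact: pintegrableB|by apply: pintegrableZ; exact: pintegrable_norm|].
by move=> x _; rewrite -mulrBr normrM mulrC ler_wpM2r.
Qed.

End absolutely_summable.

Lemma wave_split k th (x : R) :
  wave k th x = cos th * wave k 0 x - sin th * wave k (- (pi / 2)) x.
Proof. by rewrite -sin_wave -cos_wave /wave cosD mulrC [sin _ * sin _]mulrC. Qed.

(** Termwise integration shows that [w] and its series have the same integral against every wave,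
    frequency 0 included because [w] has zero mean; completeness then annihilates their
    difference. *)
Lemma fourier_ae w : pintegrable w -> 'I w = 0 ->
  let a k := pi^-1 * cosc w k in let b k := pi^-1 * sinc w k in
  cvgn (series (fun k => `|a k| + `|b k|)) ->
  {ae mu, forall x : R, 0 < x < 2 * pi -> w x = trig_series a b x}.
Proof.
move=> wi w0 a b cab.
have cv := continuous_trig_series cab; have vi := pintegrable_continuous cv.
have coef j th : 'I (fun x => wave j th x * trig_series a b x) = 'I (fun x => w x * wave j th x).
  have := cvg_pintegral_mul_trig_sum cab (@pintegrable_wave R j th).
  suff : (fun N => 'I (fun x => wave j th x * trig_sum a b N x)) @ \oo --> 'I (fun x => w x * wave j th x).
    by move=> /cvg_lim H1 /cvg_lim H2; rewrite -H1// -H2.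
  case: j => [|j].
    apply: cvg_near_cst; near=> N; rewrite wave0.
    rewrite pintegralZ ?pintegrable_trig_sum// pintegral_trig_sum mulr0.
    by under eq_Rintegral do rewrite /cst mulrC; rewrite pintegralZ// w0 mulr0.
  apply: cvg_near_cst; exists j.+1 => // N /= jN.
  rewrite pintegral_wave_trig_sum jN.
  have -> : 'I (fun x => w x * wave j.+1 th x) = cos th * cosc w j - sin th * sinc w j.
    have iw t : pintegrable (fun x => w x * wave j.+1 t x) by apply: pintegrableM => //; exact: continuous_wave.
    rewrite /cosc /sinc -!pintegralZ// -pintegralB; [|exact: pintegrableZ..].
    by apply: eq_pintegral => x _; rewrite wave_split; ring.
  by rewrite /a /b; have := @pi_neq0 R; move: (pi : R) => p p0; field.
have od : orth (fun x => w x - trig_series a b x).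
  split; first exact: pintegrableB.
  move=> k th; apply: (@eq_trans _ _ ('I (fun x => w x * wave k th x) -
      'I (fun x => wave k th x * trig_series a b x))); last by rewrite coef subrr.
  rewrite -pintegralB; first by apply: eq_pintegral => x _; ring.
  - by apply: pintegrableM => //; exact: continuous_wave.
  - by apply: pintegrableM => //; exact: pintegrable_wave.
have := orth_ae0 od; apply: filterS; first exact: (ae_filter_ringOfSetsType mu).
by move=> x /= H /H /eqP; rewrite subr_eq0 => /eqP.
Unshelve. all: by end_near. Qed.

Lemma ae_neq c : {ae mu, forall x : R, x != c}.
Proof.
exists [set c]; split; [exact: measurable_set1|exact: lebesgue_measure_set1|].
by move=> x /= /negP; rewrite negbK => /eqP.
Qed.

Lemma ae_eq_pintegral f g : pintegrable f -> pintegrable g -> {ae mu, forall x : R, 0 < x < 2 * pi -> f x = g x} ->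
  'I f = 'I g.
Proof.
move=> fi gi fg; congr fine; apply: ae_eq_integral.
- exact: measurable_period.
- exact: measurable_int fi.
- exact: measurable_int gi.
have FF := ae_filter_ringOfSetsType mu.
have := filterI fg (filterI (ae_neq 0) (ae_neq (2 * pi))).
move=> /(_ FF FF); apply: (@filterS _ _ FF) => x /= [H [x0 x2]]; rewrite /period/= in_itv/= => /andP[x0' x2'].
by congr EFin; apply: H; rewrite !lt_neqAle eq_sym x0 x2 x0'.
Qed.

(** One factor of [w * w] is replaced by the Fourier series and integrated term by term. *)
Lemma parseval w : square_integrable w -> 'I w = 0 ->
  let a k := pi^-1 * cosc w k in let b k := pi^-1 * sinc w k in
  cvgn (series (fun k => `|a k| + `|b k|)) ->
  (fun N => pi^-1 * \sum_(k < N) (cosc w k ^+ 2 + sinc w k ^+ 2)) @ \oo -->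
  'I (fun x => w x ^+ 2).
Proof.
move=> w2 w0 a b cab; have wi := pintegrable_of_square w2.
have -> : 'I (fun x => w x ^+ 2) = 'I (fun x => w x * trig_series a b x).
  apply: ae_eq_pintegral; [exact: w2.2|by apply: pintegrableM => //; exact: continuous_trig_series|].
  have := fourier_ae wi w0 cab; apply: filterS; first exact: (ae_filter_ringOfSetsType mu).
  by move=> x /= H /H <-; rewrite expr2.
apply: cvg_trans (cvg_pintegral_mul_trig_sum cab wi); apply: near_eq_cvg; near=> N.
by rewrite pintegral_mul_trig_sum// mulr_sumr; apply: eq_bigr => k _; rewrite /a /b; ring.
Unshelve. all: by end_near. Qed.

End fourier_series.

(** * The series F(s): monotonicity and telescoping bounds *)

Section pole_series.
Context {R : realType}.
Implicit Types (s t : R) (k N : nat) (g : nat -> R).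

(** The index is shifted so that [k = 0] is frequency 1. The poles lie at [s <= -1], whence the
    condition [-1 < s] throughout. *)
Definition pole_term s k : R := (k.+1%:R ^+ 2 + s)^-1.

Definition pole_series s : R := limn (series (pole_term s)).

Lemma sqr_natS_ge k : (1 : R) <= k.+1%:R ^+ 2.
Proof. by rewrite expr_ge1// ler1n. Qed.

Lemma pole_den_gt0 s k : -1 < s -> 0 < k.+1%:R ^+ 2 + s.
Proof. by have := sqr_natS_ge k; lra. Qed.

Lemma pole_term_gt0 s k : -1 < s -> 0 < pole_term s k.
Proof. by move=> s1; rewrite invr_gt0 pole_den_gt0. Qed.

Lemma series_pole_nd s : -1 < s -> nondecreasing_seq (series (pole_term s)).
Proof.
move=> s1; apply/nondecreasing_seqP => n; rewrite seriesSr lerDl ltW//.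
exact: pole_term_gt0.
Qed.

(** A comparison with [g k - g k.+1] lets [g N] play the role of the remainder beyond [N]. *)
Lemma series_le_telescope s g N M : (N <= M)%N ->
  (forall k, (N <= k)%N -> pole_term s k <= g k - g k.+1) ->
  series (pole_term s) M <= series (pole_term s) N + g N - g M.
Proof.
move=> + Hg; elim: M => [|M IH]; first by rewrite leqn0 => /eqP ->; rewrite addrK.
rewrite leq_eqVlt => /predU1P[->|]; first by rewrite addrK.
by rewrite ltnS => NM; rewrite seriesSr; have := IH NM; have := Hg _ NM; lra.
Qed.

Lemma series_ge_telescope s g N M : (N <= M)%N ->
  (forall k, (N <= k)%N -> g k - g k.+1 <= pole_term s k) ->
  series (pole_term s) N + g N - g M <= series (pole_term s) M.
Proof.
move=> + Hg; elim: M => [|M IH]; first by rewrite leqn0 => /eqP ->; rewrite addrK.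
rewrite leq_eqVlt => /predU1P[->|]; first by rewrite addrK.
by rewrite ltnS => NM; rewrite seriesSr; have := IH NM; have := Hg _ NM; lra.
Qed.

(** For frequencies [n >= 2], [n^2 + s >= (n - 1) n], so the terms are dominated by
    [1 / (n - 1) - 1 / n]. Only the first term blows up as [s] tends to [-1]. *)
Lemma cvg_series_pole s : -1 < s -> cvgn (series (pole_term s)).
Proof.
move=> s1; apply: nondecreasing_is_cvgn; first exact: series_pole_nd.
exists (series (pole_term s) 1%N + 1) => _ [M _ <-].
have g0 k : (0 : R) <= k%:R^-1 by rewrite invr_ge0.
apply: (@le_trans _ _ (series (pole_term s) M.+1)).
  by rewrite seriesSr lerDl ltW// pole_term_gt0.
apply: le_trans (@series_le_telescope s (fun k => k%:R^-1) 1 M.+1 _ _) _ => //.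
  case=> // k _; have k1 : (0 : R) < k.+1%:R by rewrite ltr0n.
  have k2 : (0 : R) < k.+2%:R by rewrite ltr0n.
  have -> : k.+1%:R^-1 - k.+2%:R^-1 = (k.+1%:R * k.+2%:R)^-1 :> R.
    move: k1 k2; rewrite -[k.+2%:R]natr1; move: (k.+1%:R : R) => y y0 y1.
    by field; rewrite !gt_eqF.
  rewrite /pole_term lef_pV2 ?posrE ?mulr_gt0//; last exact: pole_den_gt0.
  by rewrite -[k.+2%:R]natr1; move: (k.+1%:R : R) k1 => y y0; nra.
by rewrite invr1 gerBl.
Qed.

Lemma pole_series_ge s N : -1 < s -> series (pole_term s) N <= pole_series s.
Proof.
by move=> s1; apply: nondecreasing_cvgn_le; [exact: series_pole_nd|exact: cvg_series_pole].
Qed.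

Lemma pole_series_gt0 s : -1 < s -> 0 < pole_series s.
Proof.
move=> s1; apply: lt_le_trans (pole_series_ge 1 s1).
by rewrite seriesEnat/= big_nat1 pole_term_gt0.
Qed.

Lemma pole_series_le_telescope s g N : -1 < s -> (forall k, 0 <= g k) ->
  (forall k, (N <= k)%N -> pole_term s k <= g k - g k.+1) ->
  pole_series s <= series (pole_term s) N + g N.
Proof.
move=> s1 g0 Hg; apply: limr_le; first exact: cvg_series_pole.
exists N => // M /= NM; apply: le_trans (series_le_telescope NM Hg) _.
by rewrite gerBl.
Qed.

Lemma pole_series_ge_telescope s g N : -1 < s -> g @ \oo --> 0 ->
  (forall k, (N <= k)%N -> g k - g k.+1 <= pole_term s k) ->
  series (pole_term s) N + g N <= pole_series s.
Proof.
move=> s1 g0 Hg.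
have H : (fun M => series (pole_term s) N + g N - g M) @ \oo --> series (pole_term s) N + g N.
  by rewrite -[X in _ --> X]subr0; apply: cvgB => //; exact: cvg_cst.
apply: (ler_cvg_to H (cvg_series_pole s1)).
by exists N => // M /= NM; exact: series_ge_telescope.
Qed.

Lemma pole_series_anti s t : -1 < s -> s <= t -> pole_series t <= pole_series s.
Proof.
move=> s1 st; have t1 := lt_le_trans s1 st.
apply: lim_series_le; [exact: cvg_series_pole..|move=> k].
by rewrite /pole_term lef_pV2 ?posrE ?pole_den_gt0// lerD2l.
Qed.

(* Each [(1 + s) / (k ^ 2 + s)] is nondecreasing in [s]. *)
Lemma pole_series_mul_nd s t : -1 < s -> s <= t ->
  (1 + s) * pole_series s <= (1 + t) * pole_series t.
Proof.
move=> s1 st; have t1 := lt_le_trans s1 st.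
have H u : -1 < u -> (fun M => (1 + u) * series (pole_term u) M) @ \oo --> (1 + u) * pole_series u.
  by move=> u1; apply: cvgM; [exact: cvg_cst|exact: cvg_series_pole].
apply: (ler_cvg_to (H s s1) (H t t1)); near=> M.
rewrite /series/= !mulr_sumr ler_sum// => k _; rewrite /pole_term.
rewrite ler_pdivrMr ?pole_den_gt0// mulrAC ler_pdivlMr ?pole_den_gt0//.
by have := sqr_natS_ge k; nra.
Unshelve. all: by end_near. Qed.

(** Continuity at 0 follows from the two opposite monotonicities: [F(s)] lies between [F(0)] and
    [F(0) / (1 + s)]. *)
Lemma pole_series_cvg0 : pole_series @ 0^' --> pole_series 0.
Proof.
have F0 : 0 < pole_series 0 by apply: pole_series_gt0; lra.
apply/cvgrPdist_le => e e0.
(* With [|s| < 1/2], [F(s) <= 2 F(0)] on either side, and the error is then at most [2 |s| F(0)]. *)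
pose d := Num.min (1 / 2) (e / (2 * pole_series 0)).
have d0 : 0 < d by rewrite /d lt_min !divr_gt0// mulr_gt0.
have [d1 d2] : d <= 1 / 2 /\ d <= e / (2 * pole_series 0).
  by rewrite /d; split; rewrite ge_min lexx ?orbT.
move: d2; rewrite ler_pdivlMr ?mulr_gt0// => d2.
exists d => //= s /=; rewrite sub0r normrN ltr_norml => /andP[sd ds] _.
have s1 : -1 < s by lra.
rewrite ler_distl; apply/andP; split.
  have [s0|s0] := leP 0 s.
    by have := pole_series_anti (_ : -1 < 0 :> R) s0 => /(_ ltac:(lra)); nra.
  have := pole_series_mul_nd s1 (ltW s0); nra.
have [s0|s0] := leP 0 s.
  have := pole_series_mul_nd (_ : -1 < 0 :> R) s0 => /(_ ltac:(lra)).
  have := pole_series_gt0 s1; nra.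
have := pole_series_anti s1 (ltW s0); nra.
Qed.

End pole_series.

(** * Mittag-Leffler expansion from a Fourier series *)

Section mittag_leffler.
Context {R : realType}.
Local Notation mu := (@lebesgue_measure R).
Local Notation P := (@period R).
Implicit Types (f g c sg : R -> R) (s : R) (k : nat).
Local Notation "''I' f" := (\int[mu]_(x in P) f x) (at level 10, f at level 9).

Lemma ae_itv_exists (Q : R -> Prop) (x y : R) : x < y -> {ae mu, forall z : R, Q z} ->
  exists z, x < z < y /\ Q z.
Proof.
move=> xy [N [mN N0 QN]]; apply: contrapT => nQ.
have sub : `]x, y[ `<=` N.
  move=> z /=; rewrite in_itv/= => zxy; apply: QN => /= Qz.
  by apply: nQ; exists z.
have : (mu `]x, y[ <= mu N)%E by apply: le_measure => //; rewrite inE//; exact: measurable_itv.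
rewrite [X in (_ <= X)%E -> _]N0 lebesgue_measure_itv/= lte_fin xy -EFinB lee_fin.
by lra.
Qed.

(** The point 0 is an end of the interval, so it is reached only as a limit of points where the
    identity holds. *)
Lemma ae_eq_at0 f g : continuous f -> continuous g ->
  {ae mu, forall x : R, 0 < x < 2 * pi -> f x = g x} -> f 0 = g 0.
Proof.
move=> cf cg fg; apply/eqP/negPn/negP => fg0.
have cd : {for 0, continuous (fun x => f x - g x)} by apply: cvgB; [exact: cf|exact: cg].
have e0 : 0 < `|f 0 - g 0| by rewrite normr_gt0 subr_eq0.
have /cvgrPdist_lt/(_ _ e0)[d /= d0 Hd] := cd.
have m0 : 0 < Num.min d (2 * pi) by rewrite lt_min d0 twopi_gt0.
have [z [/andP[z0]]] := ae_itv_exists m0 fg.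
rewrite lt_min => /andP[zd z2] Hz.
have := Hd z; rewrite /= sub0r normrN gtr0_norm// => /(_ zd).
by rewrite Hz ?z0// subrr subr0 ltxx.
Qed.

Lemma is_derive_pi_sub (x : R) : is_derive x 1 (fun y : R => pi - y) (-1).
Proof. by apply: is_derive_eq; rewrite add0r mul1r. Qed.

(** The pair stands for [cosh (r x)], [sinh (r x) / r] when [s = r^2], and for [cos (r x)],
    [sin (r x) / r] when [s = - r^2]; with this normalization [c' = s sg] and [sg' = c] cover both
    signs. *)
Lemma trig_pair_integral c sg s k th :
  (forall x : R, is_derive x 1 c (s * sg x)) -> (forall x : R, is_derive x 1 sg (c x)) ->
  (forall x, c (- x) = c x) -> (forall x, sg (- x) = - sg x) -> -1 < s ->
  'I (fun x => c (pi - x) * wave k.+1 th x) = 2 * s * sg pi * cos th * pole_term s k.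
Proof.
move=> dc dsg ce so s1.
have dl := is_derive_pi_sub.
have dp (x : R) : is_derive x 1 (fun y => c (pi - y)) (- (s * sg (pi - x))).
  have H := @is_derive1_comp _ c (fun y => pi - y) x _ _ (dc (pi - x)) (dl x).
  by apply: (@is_derive_eq _ _ _ _ _ _ _ _ H); rewrite /GRing.scale/= mulrN1.
have dq (x : R) : is_derive x 1 (fun y => sg (pi - y)) (- c (pi - x)).
  have H := @is_derive1_comp _ sg (fun y => pi - y) x _ _ (dsg (pi - x)) (dl x).
  by apply: (@is_derive_eq _ _ _ _ _ _ _ _ H); rewrite /GRing.scale/= mulrN1.
have cont f df : (forall x : R, is_derive x 1 f (df x)) -> continuous f.
  by move=> d x; apply: differentiable_continuous; apply/derivable1_diffP; apply: ex_derive.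
pose n := (k.+1%:R : R).
pose p x := c (pi - x).
pose q x := sg (pi - x).
pose W := wave k.+1 th.
pose V := wave k.+1 (th - pi / 2).
have dW (x : R) : is_derive x 1 W (- (n * V x)).
  apply: (@is_derive_eq _ _ _ _ _ _ _ _ (is_derive_wave k.+1 th x)).
  by rewrite /V /wave addrA cosBpihalf.
have dV (x : R) : is_derive x 1 V (n * W x).
  apply: (@is_derive_eq _ _ _ _ _ _ _ _ (is_derive_wave k.+1 (th - pi / 2) x)).
  by rewrite /W /wave addrA sinBpihalf mulrN opprK.
have den : n ^+ 2 + s != 0 by rewrite gt_eqF// pole_den_gt0.
(* The antiderivative produced by integrating by parts twice: in [E'] the mixed terms [q * V] cancel
   and [p * W] gets the factor [n^2 + s]. *)
pose E x := (n ^+ 2 + s)^-1 * (- s * (q x * W x) + n * (p x * V x)).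
transitivity (E (2 * pi) - E 0).
  apply: pintegral_FTC2.
    move=> x; apply: cvgM; first exact: (cont _ _ dp).
    exact: continuous_wave.
  move=> x.
  have H1 := is_deriveZ (- s) (is_deriveM (dq x) (dW x)).
  have H2 := is_deriveZ n (is_deriveM (dp x) (dV x)).
  have H := is_deriveZ (n ^+ 2 + s)^-1 (is_deriveD H1 H2).
  apply: (@is_derive_eq _ _ _ _ _ _ _ _ H); rewrite /GRing.scale/=.
  rewrite [X in _ * X = _](_ : _ = (n ^+ 2 + s) * (c (pi - x) * W x)); last by ring.
  by rewrite mulKf.
have -> : E (2 * pi) = (n ^+ 2 + s)^-1 * (s * (sg pi * cos th) + n * (c pi * V 0)).
  rewrite /E /q /p /W /V -[2 * pi]add0r !periodic_wave add0r.
  have -> : pi - 2 * pi = - pi :> R by ring.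
  by rewrite so ce /wave mulr0 !add0r; ring.
rewrite /E /q /p /W subr0 /pole_term -/n {1}/wave mulr0 add0r.
by move: den; move: (n ^+ 2 + s) => D D0; field.
Qed.

(** The function [c (pi - x)] minus its mean is symmetric about [pi], so its sine coefficients
    vanish, and its cosine coefficients are multiples of [pole_term s]. Its value [c pi - m] at 0 is
    the sum of the series. *)
Lemma mittag_leffler c sg s :
  (forall x : R, is_derive x 1 c (s * sg x)) -> (forall x : R, is_derive x 1 sg (c x)) ->
  (forall x, c (- x) = c x) -> (forall x, sg (- x) = - sg x) ->
  -1 < s -> s != 0 -> sg pi != 0 ->
  (c pi / sg pi - pi^-1) / s = 2 / pi * pole_series s.
Proof.
move=> dc dsg ce so s1 s0 sp0.
have cont f df : (forall x : R, is_derive x 1 f (df x)) -> continuous f.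
  by move=> d x; apply: differentiable_continuous; apply/derivable1_diffP; apply: ex_derive.
have dl := is_derive_pi_sub.
have cp : continuous (fun x => c (pi - x)).
  move=> x; apply: (@continuous_comp _ _ _ (fun y => pi - y) c).
    exact: (cont _ _ dl).
  exact: (cont _ _ dc).
have Ip : 'I (fun x => c (pi - x)) = 2 * sg pi.
  pose E x := - sg (pi - x).
  transitivity (E (2 * pi) - E 0).
    apply: pintegral_FTC2 => // x.
    have H := @is_derive1_comp _ sg (fun y => pi - y) x _ _ (dsg (pi - x)) (dl x).
    apply: (@is_derive_eq _ _ _ _ _ _ _ _ (is_deriveN H)).
    by rewrite /GRing.scale/= mulrN1 opprK.
  rewrite /E subr0; have -> : pi - 2 * pi = - pi :> R by ring.
  by rewrite so; ring.
pose m : R := pi^-1 * sg pi.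
pose w x := c (pi - x) - m.
have cw : continuous w by move=> x; apply: cvgB; [exact: cp|exact: cvg_cst].
have wi := pintegrable_continuous cw.
have w0 : 'I w = 0.
  rewrite pintegralB ?pintegral_cst ?Ip; [|exact: pintegrable_continuous|exact: pintegrable_cst].
  by rewrite -mulrA mulVKf ?subrr// pi_neq0.
have coef k th : 'I (fun x => w x * wave k.+1 th x) = 2 * s * sg pi * cos th * pole_term s k.
  rewrite -(trig_pair_integral k th dc dsg ce so s1).
  transitivity ('I (fun x => c (pi - x) * wave k.+1 th x) - m * 'I (wave k.+1 th)).
    rewrite -pintegralZ ?pintegrable_wave// -pintegralB; first by apply: eq_pintegral => x _; rewrite mulrBl.
    - by apply: pintegrableM; [exact: pintegrable_continuous|exact: continuous_wave].
    - exact/pintegrableZ/pintegrable_wave.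
  by rewrite pintegral_wave// mulr0 subr0.
have A k : pi^-1 * cosc w k = pi^-1 * (2 * s * sg pi) * pole_term s k.
  by rewrite /cosc coef cos0; ring.
have B k : pi^-1 * sinc w k = 0.
  by rewrite /sinc coef cosN cos_pihalf; ring.
have cs : cvgn (series (fun k => `|pi^-1 * cosc w k| + `|pi^-1 * sinc w k|)).
  rewrite (_ : (fun k => _) = `|pi^-1 * (2 * s * sg pi)| *: pole_term s); last first.
    apply/funext => k; rewrite B A normr0 addr0 normrM.
    by rewrite [X in _ * X]gtr0_norm// pole_term_gt0.
  by apply: is_cvg_seriesZ; exact: cvg_series_pole.
have w00 : w 0 = pi^-1 * (2 * s * sg pi) * pole_series s.
  rewrite (ae_eq_at0 cw (continuous_trig_series cs) (fourier_ae wi w0 cs)).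
  apply/cvg_lim => //.
  rewrite (_ : (fun N => _) = (fun N => pi^-1 * (2 * s * sg pi) * series (pole_term s) N)).
    by apply: cvgM; [exact: cvg_cst|exact: cvg_series_pole].
  apply/funext => N; rewrite /trig_sum /series/= big_mkord mulr_sumr.
  by apply: eq_bigr => k _; rewrite B A /wave mulr0 addr0 cos0; ring.
have : c pi = m + pi^-1 * (2 * s * sg pi) * pole_series s.
  by rewrite -w00 /w subr0; ring.
move=> ->; rewrite /m; have := @pi_neq0 R.
move: (pole_series s) sp0; move: (sg pi) => y F y0; move: (pi : R) => p p0.
by field; rewrite p0 s0.
Qed.

End mittag_leffler.

(** * The quotient as a series *)

Section quotient_formula.
Context {R : realType}.
Implicit Types (s r : R).

Lemma is_derive_comp_lin f df r (x : R) : (forall y : R, is_derive y 1 f (df y)) ->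
  is_derive x 1 (fun y : R => f (r * y)) (r * df (r * x)).
Proof.
move=> d; have dl : is_derive x 1 (fun y : R => r * y) r.
  have H := is_deriveZ r (is_derive_id x 1).
  by apply: (@is_derive_eq _ _ _ _ _ _ _ _ H); rewrite /GRing.scale/= mulr1.
have H := @is_derive1_comp _ f (fun y => r * y) x _ _ (d (r * x)) dl.
by apply: (@is_derive_eq _ _ _ _ _ _ _ _ H); rewrite /GRing.scale/= mulrC.
Qed.

Lemma quotient0_gt0 s : 0 < s -> quotient0 s = 2 / pi * pole_series s.
Proof.
move=> s0; set r := Num.sqrt s.
have r0 : 0 < r by rewrite sqrtr_gt0.
have rs : s = r ^+ 2 by rewrite sqr_sqrtr// ltW.
pose c (x : R) := 2^-1 * (expR (r * x) + expR (- r * x)).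
pose sg (x : R) := (2 * r)^-1 * (expR (r * x) - expR (- r * x)).
have de t (x : R) : is_derive x 1 (fun y : R => expR (t * y)) (t * expR (t * x)).
  by apply: (@is_derive_comp_lin expR expR).
have diff0 : expR (r * pi) - expR (- r * pi) != 0.
  by rewrite subr_eq0 gt_eqF// ltr_expR mulNr gtrN ?mulr_gt0 ?pi_gt0.
have := @mittag_leffler R c sg s.
have -> : c pi / sg pi = sqrt_coth s.
  rewrite /sqrt_coth s0 /coth -/r /c /sg ![pi * r]mulrC -mulNr.
  move: diff0 r0; move: (expR (r * pi)) (expR (- r * pi)) => a b ab r0.
  by field; rewrite ab gt_eqF.
apply.
- move=> x; have H := is_deriveZ 2^-1 (is_deriveD (de r x) (de (- r) x)).
  apply: (@is_derive_eq _ _ _ _ _ _ _ _ H).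
  rewrite /GRing.scale/= /sg rs; move: r0 (expR _) (expR _) => r0 a b.
  by field; rewrite gt_eqF.
- move=> x; have H := is_deriveZ (2 * r)^-1 (is_deriveB (de r x) (de (- r) x)).
  apply: (@is_derive_eq _ _ _ _ _ _ _ _ H).
  rewrite /GRing.scale/= /c; move: r0 (expR _) (expR _) => r0 a b.
  by field; rewrite gt_eqF.
- by move=> x; rewrite /c !mulrN mulNr opprK addrC.
- by move=> x; rewrite /sg !mulrN !mulNr opprK -opprB mulrN.
- by lra.
- by rewrite gt_eqF.
- by rewrite mulf_neq0// invr_neq0// mulf_neq0 ?gt_eqF// pnatr_eq0.
Qed.

Lemma quotient0_lt0 s : -1 < s -> s < 0 -> quotient0 s = 2 / pi * pole_series s.
Proof.
move=> s1 s0; set r := Num.sqrt (- s).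
have r0 : 0 < r by rewrite sqrtr_gt0 oppr_gt0.
have rs : s = - r ^+ 2 by rewrite sqr_sqrtr ?opprK// oppr_ge0 ltW.
(* This keeps [r * pi] inside [(0, pi)], where the sine in the denominator is positive. *)
have r1 : r < 1.
  by rewrite ltNge; apply/negP => r1; have : 1 <= r ^+ 2 by [rewrite expr_ge1// ltW]; lra.
pose c (x : R) := cos (r * x).
pose sg (x : R) := r^-1 * sin (r * x).
have sin0 : 0 < sin (r * pi).
  by rewrite sin_gt0_pi// mulr_gt0 ?pi_gt0//= gtr_pMl ?pi_gt0.
have := @mittag_leffler R c sg s.
have -> : c pi / sg pi = sqrt_coth s.
  rewrite /sqrt_coth ltNge ltW//= /cot -/r /c /sg ![pi * r]mulrC.
  move: sin0 r0; move: (sin (r * pi)) (cos (r * pi)) => a b a0 r0.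
  by field; rewrite !gt_eqF.
have dcos (x : R) : is_derive x 1 (fun y : R => cos (r * y)) (r * - sin (r * x)).
  by apply: (@is_derive_comp_lin cos (fun y => - sin y)).
have dsin (x : R) : is_derive x 1 (fun y : R => sin (r * y)) (r * cos (r * x)).
  by apply: (@is_derive_comp_lin sin cos).
apply.
- move=> x; apply: (@is_derive_eq _ _ _ _ _ _ _ _ (dcos x)).
  by rewrite /sg rs; move: r0 (sin _) => r0 a; field; rewrite gt_eqF.
- move=> x; have H := is_deriveZ r^-1 (dsin x).
  apply: (@is_derive_eq _ _ _ _ _ _ _ _ H).
  by rewrite /GRing.scale/= /c mulKf// gt_eqF.
- by move=> x; rewrite /c mulrN cosN.
- by move=> x; rewrite /sg mulrN sinN mulrN.
- by [].
- by rewrite lt_eqF.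
- by rewrite mulf_neq0// ?invr_neq0 ?gt_eqF.
Qed.

Lemma quotient_pole_series s : -1 < s -> quotient s = 2 / pi * pole_series s.
Proof.
move=> s1; rewrite /quotient; case: eqVneq => [->|s0]; last first.
  have /orP[s0'|s0'] : (s < 0) || (0 < s) by rewrite -neq_lt.
    exact: quotient0_lt0.
  exact: quotient0_gt0.
apply/cvg_lim => //.
have H : (fun t => 2 / pi * pole_series t) @ (0 : R)^' --> 2 / pi * pole_series (0 : R).
  by apply: cvgM; [exact: cvg_cst|exact: pole_series_cvg0].
apply: cvg_trans H; apply: near_eq_cvg; exists 1 => //= t /=.
rewrite sub0r normrN ltr_norml => /andP[t1 _] t0.
have /orP[t0'|t0'] : (t < 0) || (0 < t) by rewrite -neq_lt.
  by rewrite quotient0_lt0.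
by rewrite quotient0_gt0.
Qed.

End quotient_formula.

(** * From one period to the whole line *)

Section periodic_ae.
Context {R : realType}.
Local Notation mu := (@lebesgue_measure R).

Lemma measurable_addr (c : R) :
  measurable_fun setT ((fun x => x + c) : measurableTypeR R -> measurableTypeR R).
Proof.
apply: continuous_measurable_fun => x.
by apply: cvgD; [exact: cvg_id|exact: cvg_cst].
Qed.

(** Translation invariance, by uniqueness of the measure with the given values on half-open
    intervals. *)
Lemma lebesgue_measureD (c : R) (A : set R) : measurable (A : set (measurableTypeR R)) ->
  pushforward mu ((fun x => x + c) : measurableTypeR R -> measurableTypeR R) A = mu A.
Proof.
move=> mA; apply/esym; apply: lebesgue_measure_unique => //=; first exact: measurable_addr.
move=> _ _ [[a b]] _ <-; rewrite /pushforward.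
have -> : (fun x => x + c) @^-1` `]a, b] = `]a - c, b - c]%classic.
  by apply/seteqP; split => x /=; rewrite !in_itv/= ltrBlDr lerBrDr.
rewrite !lebesgue_measure_itv/= !lte_fin ltrD2r; case: ifPn => // _.
by rewrite -!EFinB; congr EFin; ring.
Qed.

Lemma negligible_shift (c : R) (N : set R) : mu.-negligible N ->
  mu.-negligible [set x | N (x + c)].
Proof.
move=> [M [mM M0 NM]]; exists [set x | M (x + c)]; split.
- have := @measurable_addr c; move=> /(_ measurableT _ mM).
  by rewrite setTI.
- by rewrite -M0; exact: lebesgue_measureD.
- by move=> x /=; exact: NM.
Qed.

(** The essential supremum is over the whole line, whereas Fourier identities hold on an open
    period; countably many translates of a null set remain null. *)
Lemma ae_periodic (Q : R -> Prop) : (forall x, Q (x + 2 * pi) <-> Q x) ->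
  {ae mu, forall x : R, 0 < x < 2 * pi -> Q x} -> {ae mu, forall x : R, Q x}.
Proof.
move=> Qp Qae; have p0 := @twopi_gt0 R.
have Qn (n : nat) x : Q (x + n%:R * (2 * pi)) <-> Q x.
  elim: n => [|n IH]; first by rewrite mul0r addr0.
  have -> : x + n.+1%:R * (2 * pi) = x + n%:R * (2 * pi) + 2 * pi.
    by rewrite -natr1; ring.
  by rewrite Qp IH.
(* The half-open period is chosen since its translates tile the line; the added endpoint is null. *)
pose N := [set x | ~ (0 <= x < 2 * pi -> Q x)].
have N0 : mu.-negligible N.
  have H : {ae mu, forall x : R, 0 <= x < 2 * pi -> Q x}.
    have FF := ae_filter_ringOfSetsType mu.
    have := filterI Qae (ae_neq 0).
    move=> /(_ FF); apply: (@filterS _ _ FF) => x /= [H x0] /andP[x0' x2].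
    by apply: H; rewrite x2 lt_neqAle eq_sym x0 x0'.
  exact: H.
pose F n := [set x | N (x + n%:R * (2 * pi))] `|` [set x | N (x + - (n%:R * (2 * pi)))].
have : mu.-negligible (\bigcup_n F n).
  by apply: negligible_bigcup => n; apply: negligibleU; exact: negligible_shift.
apply: negligibleS => x /= nQ.
pose z := Num.floor (x / (2 * pi)).
have zx : z%:~R * (2 * pi) <= x by rewrite -ler_pdivlMr// floor_le_tmp.
have xz : x < (z + 1)%:~R * (2 * pi) by rewrite -ltr_pdivrMr// floorD1_gt.
rewrite intrD mulrDl mul1r in xz.
case: (intP z) zx xz => [|n|n].
- rewrite mul0r add0r => x0 x2; exists 0%N => //; left; rewrite /= mul0r addr0 /N/= => H.
  by apply: nQ; apply: H; rewrite x0.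
- move=> zx xz; exists n.+1 => //; right; rewrite /N/= => H; apply: nQ.
  have := (Qn n.+1 (x - n.+1%:R * (2 * pi))).2 (H _); rewrite subrK; apply.
  by apply/andP; split; rewrite ?subr_ge0 ?ltrBlDr; [|rewrite addrC].
- rewrite mulrNz mulNr => zx xz; exists n.+1 => //; left; rewrite /N/= => H; apply: nQ.
  apply: ((Qn n.+1 x).1 (H _)).
  by apply/andP; split; [rewrite -lerBlDr sub0r|rewrite -ltrBrDr addrC].
Qed.

End periodic_ae.

(** * Energy estimates and the pointwise bound *)

Section energy.
Context {R : realType}.
Local Notation mu := (@lebesgue_measure R).
Local Notation P := (@period R).
Implicit Types (f g h u w : R -> R) (a b : nat -> R) (s c th : R) (k j N : nat).
Local Notation "''I' f" := (\int[mu]_(x in P) f x) (at level 10, f at level 9).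

Lemma C1_periodic_wave k th : C1_periodic (wave k th).
Proof.
split; first exact: periodic_wave.
- by move=> x; apply: ex_derive; exact: is_derive_wave.
- rewrite derive_wave => x; apply: cvgM; first exact: cvg_cst.
  exact: continuous_wave.
Qed.

(** Waves are themselves admissible periodic test functions, and their derivatives are waves with
    shifted phase. *)
Lemma weak_derivative_coef u g k : square_integrable u -> weak_derivative u g ->
  cosc g k = k.+1%:R * sinc u k /\ sinc g k = - (k.+1%:R * cosc u k).
Proof.
move=> u2 ug; have ui := pintegrable_of_square u2.
have H th : 'I (fun x => g x * wave k.+1 th x) = - (k.+1%:R * 'I (fun x => u x * wave k.+1 (th + pi / 2) x)).
  have := ug _ (C1_periodic_wave k.+1 th); rewrite derive_wave => /eqP.
  rewrite -eqr_opp opprK => /eqP <-; congr (- _).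
  rewrite -pintegralZ; last by apply: pintegrableM => //; exact: continuous_wave.
  by apply: eq_pintegral => x _; ring.
split; rewrite /cosc /sinc H.
  rewrite -mulrN; congr (_ * _); rewrite -mulN1r -pintegralZ; last by apply: pintegrableM => //; exact: continuous_wave.
  apply: eq_pintegral => x _; rewrite add0r mulN1r -mulrN; congr (_ * _).
  by rewrite /wave cosDpihalf cosBpihalf opprK.
by rewrite addNr.
Qed.

Lemma add_le_sqr (n x y : R) : 0 < n ->
  x + y <= n ^+ 2 * (x ^+ 2 + y ^+ 2) + (n ^+ 2)^-1.
Proof.
move=> n0; have amgm z : z <= 2^-1 * (n ^+ 2 * z ^+ 2) + 2^-1 * (n ^+ 2)^-1.
  have -> : 2^-1 * (n ^+ 2 * z ^+ 2) + 2^-1 * (n ^+ 2)^-1 = z + 2^-1 * (n * z - n^-1) ^+ 2.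
    by field; rewrite gt_eqF.
  by rewrite lerDl mulr_ge0// sqr_ge0.
have := amgm x; have := amgm y; have := sqr_ge0 (n * x); have := sqr_ge0 (n * y).
by rewrite !exprMn; lra.
Qed.

(** By AM-GM [|a| + |b| <= n^2 (a^2 + b^2) + 1 / n^2] at frequency [n], and both parts are
    summable. *)
Lemma summable_coef a b (B : R) :
  (forall N, \sum_(k < N) (k.+1%:R ^+ 2 * (a k ^+ 2 + b k ^+ 2)) <= B) ->
  cvgn (series (fun k => `|a k| + `|b k|)).
Proof.
move=> HB; pose d k := k.+1%:R ^+ 2 * (a k ^+ 2 + b k ^+ 2).
have d0 k : 0 <= d k by rewrite mulr_ge0 ?sqr_ge0// addr_ge0 ?sqr_ge0.
have cd : cvgn (series d).
  apply: nondecreasing_is_cvgn.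
    by apply/nondecreasing_seqP => n; rewrite seriesSr lerDl.
  by exists B => _ [N _ <-]; rewrite /series/= big_mkord; exact: HB.
have cp : cvgn (series (pole_term (0 : R))) by apply: cvg_series_pole; lra.
have := is_cvg_seriesD cd cp.
apply: series_le_cvg => k; first by rewrite addr_ge0.
  by rewrite addr_ge0// ltW// pole_term_gt0//; lra.
rewrite /GRing.add/= /d /pole_term addr0.
rewrite -(real_normK (num_real (a k))) -(real_normK (num_real (b k))).
by apply: add_le_sqr; rewrite ltr0n.
Qed.

(** By induction: from [X^2 <= A B], AM-GM bounds the new cross term [2 X y] by
    [A e y^2 + B / e]. *)
Lemma weighted_cauchy (x d : nat -> R) N : (forall k, 0 < d k) ->
  (\sum_(k < N) x k) ^+ 2 <= (\sum_(k < N) (d k)^-1) * (\sum_(k < N) d k * x k ^+ 2).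
Proof.
move=> d0; elim: N => [|N IH]; first by rewrite !big_ord0 expr0n/= mul0r.
rewrite !big_ord_recr/=.
have : 0 <= \sum_(i < N) (d i)^-1 by apply: sumr_ge0 => k _; rewrite invr_ge0 ltW.
have : 0 <= \sum_(i < N) d i * x i ^+ 2.
  by apply: sumr_ge0 => k _; rewrite mulr_ge0 ?sqr_ge0// ltW.
move: IH; move: (\sum_(i < N) x i) (\sum_(i < N) (d i)^-1) (\sum_(i < N) d i * x i ^+ 2).
move=> X A B XAB B0 A0.
have := d0 N; move: (d N) (x N) => e y e0.
have -> : (A + e^-1) * (B + e * y ^+ 2) = A * B + (A * (e * y ^+ 2) + e^-1 * B) + y ^+ 2.
  by field; rewrite gt_eqF.
have E0 : 0 <= A * (e * y ^+ 2) by rewrite mulr_ge0// mulr_ge0 ?sqr_ge0// ltW.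
have F0 : 0 <= e^-1 * B by rewrite mulr_ge0// invr_ge0 ltW.
suff : 2 * (X * y) <= A * (e * y ^+ 2) + e^-1 * B.
  by rewrite sqrrD -mulr_natl => ?; lra.
apply: le_trans (ler_norm _) _.
rewrite -ler_sqr ?nnegrE ?addr_ge0// real_normK ?num_real//.
have H : (X * y) ^+ 2 <= (A * (e * y ^+ 2)) * (e^-1 * B).
  have -> : (A * (e * y ^+ 2)) * (e^-1 * B) = (A * B) * y ^+ 2 by field; rewrite gt_eqF.
  by rewrite exprMn ler_wpM2r// sqr_ge0.
move: H; move: (A * (e * y ^+ 2)) (e^-1 * B) (X * y) => E F Z H.
by have := sqr_ge0 (E - F); rewrite !expr2 in H *; nra.
Qed.

Section fourier_coefficients.
Variables (u g : R -> R).
Hypothesis ugH : H1dot_per u g.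

Let a k := pi^-1 * cosc u k.
Let b k := pi^-1 * sinc u k.

Let u2 : square_integrable u. Proof. by case: ugH. Qed.
Let g2 : square_integrable g. Proof. by case: ugH. Qed.
Let u0 : 'I u = 0. Proof. by case: ugH. Qed.

Lemma H1_bessel N :
  pi^-1 * \sum_(k < N) k.+1%:R ^+ 2 * (cosc u k ^+ 2 + sinc u k ^+ 2) <= 'I (fun x => g x ^+ 2).
Proof.
apply: le_trans (bessel N g2); rewrite ler_pM2l ?invr_gt0 ?pi_gt0// ler_sum// => k _.
have [_ _ _ ug _] := ugH; have [-> ->] := weak_derivative_coef k u2 ug.
by rewrite le_eqVlt; apply/orP; left; apply/eqP; ring.
Qed.

Lemma H1_summable : cvgn (series (fun k => `|a k| + `|b k|)).
Proof.
apply: (@summable_coef _ _ (pi^-1 * 'I (fun x => g x ^+ 2))) => N.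
apply: le_trans (_ : pi^-1 * (pi^-1 * \sum_(k < N) k.+1%:R ^+ 2 * (cosc u k ^+ 2 + sinc u k ^+ 2)) <= _).
  rewrite !mulr_sumr ler_sum// => k _; rewrite /a /b le_eqVlt; apply/orP; left; apply/eqP; ring.
by rewrite ler_pM2l ?invr_gt0 ?pi_gt0// H1_bessel.
Qed.

(** For [s < 0] Bessel's inequality for [u] points the wrong way, so Parseval is used for [u] and
    Bessel only for [g]. The weights are positive, hence the partial sum may grow to [M] before [M]
    tends to infinity. *)
Lemma H1_energy s N : -1 < s ->
  pi^-1 * \sum_(k < N) (k.+1%:R ^+ 2 + s) * (cosc u k ^+ 2 + sinc u k ^+ 2) <=
  'I (fun x => g x ^+ 2) + s * 'I (fun x => u x ^+ 2).
Proof.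
move=> s1; have cT := parseval u2 u0 H1_summable.
have cB : (fun M => 'I (fun x => g x ^+ 2) + s *
    (pi^-1 * \sum_(k < M) (cosc u k ^+ 2 + sinc u k ^+ 2))) @ \oo -->
  'I (fun x => g x ^+ 2) + s * 'I (fun x => u x ^+ 2).
  by apply: cvgD; [exact: cvg_cst|apply: cvgM => //; exact: cvg_cst].
apply: (cvgr_to_ge cB); exists N => // M /= NM.
have t0 k : 0 <= (k.+1%:R ^+ 2 + s) * (cosc u k ^+ 2 + sinc u k ^+ 2).
  apply: mulr_ge0; first by rewrite ltW// pole_den_gt0.
  by rewrite addr_ge0 ?sqr_ge0.
apply: (@le_trans _ _ (pi^-1 * \sum_(k < M) (k.+1%:R ^+ 2 + s) * (cosc u k ^+ 2 + sinc u k ^+ 2))).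
  rewrite ler_pM2l ?invr_gt0 ?pi_gt0// -!(big_mkord xpredT (fun k => (k.+1%:R ^+ 2 + s) * (cosc u k ^+ 2 + sinc u k ^+ 2))).
  by rewrite (big_cat_nat (leq0n N) NM)//= lerDl sumr_ge0.
have -> : pi^-1 * (\sum_(k < M) (k.+1%:R ^+ 2 + s) * (cosc u k ^+ 2 + sinc u k ^+ 2)) =
  pi^-1 * (\sum_(k < M) k.+1%:R ^+ 2 * (cosc u k ^+ 2 + sinc u k ^+ 2)) +
  s * (pi^-1 * \sum_(k < M) (cosc u k ^+ 2 + sinc u k ^+ 2)).
  by rewrite !mulr_sumr -big_split/=; apply: eq_bigr => k _; ring.
by rewrite lerD2r H1_bessel.
Qed.

Lemma H1_poincare : 'I (fun x => u x ^+ 2) <= 'I (fun x => g x ^+ 2).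
Proof.
apply: (cvgr_to_le (parseval u2 u0 H1_summable)); near=> N.
apply: le_trans (H1_bessel N); rewrite ler_pM2l ?invr_gt0 ?pi_gt0// ler_sum// => k _.
by rewrite ler_peMl ?addr_ge0 ?sqr_ge0// sqr_natS_ge.
Unshelve. all: by end_near. Qed.

Lemma H1_sup s : -1 < s ->
  {ae mu, forall x : R, `|u x| <= Num.sqrt (pi^-1 * pole_series s *
    ('I (fun x => g x ^+ 2) + s * 'I (fun x => u x ^+ 2)))}.
Proof.
move=> s1; set Q := 'I _ + _; set M := Num.sqrt _.
apply: ae_periodic => [x|].
  by have [up _ _ _ _] := ugH; rewrite up.
have := fourier_ae (pintegrable_of_square u2) u0 H1_summable.
apply: filterS; first exact: (ae_filter_ringOfSetsType mu).
move=> x /= H /H ->; rewrite -(ler_sqr) ?nnegrE ?sqrtr_ge0// real_normK ?num_real//.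
have Q0 : 0 <= Q by have := H1_energy 0 s1; rewrite big_ord0 mulr0.
have F0 := pole_series_gt0 s1.
have p0 : 0 < (pi : R)^-1 by rewrite invr_gt0 pi_gt0.
rewrite sqr_sqrtr; last by rewrite !mulr_ge0// ltW.
have [tau [tau0 Htau]] := trig_series_unif H1_summable.
have cx : (fun N => trig_sum a b N x) @ \oo --> trig_series a b x.
  apply/cvgrPdist_le => e e0; have /cvgrPdist_lt/(_ _ e0) := tau0.
  apply: filterS => N; rewrite /= sub0r normrN => /(le_lt_trans (ler_norm _)) tN.
  by apply: le_trans (Htau N x) _; exact: ltW.
have cx2 : (fun N => trig_sum a b N x ^+ 2) @ \oo --> trig_series a b x ^+ 2.
  by apply: cvgM.
apply: (cvgr_to_le cx2); near=> N.
have := @weighted_cauchy (fun k => a k * wave k.+1 0 x + b k * wave k.+1 (- (pi / 2)) x)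
  (fun k => k.+1%:R ^+ 2 + s) N (fun k => pole_den_gt0 k s1).
move/le_trans; apply.
apply: (@le_trans _ _ (pole_series s * (pi^-1 * Q))); last by rewrite mulrCA mulrA.
apply: ler_pM.
- by apply: sumr_ge0 => k _; rewrite invr_ge0 ltW// pole_den_gt0.
- by apply: sumr_ge0 => k _; rewrite mulr_ge0 ?sqr_ge0// ltW// pole_den_gt0.
- have := pole_series_ge N s1; rewrite /series/= big_mkord.
  exact.
have EN := H1_energy N s1; rewrite -/Q -(ler_pM2l p0) in EN; apply: le_trans EN.
rewrite !mulr_sumr ler_sum// => k _.
apply: (@le_trans _ _ ((k.+1%:R ^+ 2 + s) * (a k ^+ 2 + b k ^+ 2))); last first.
  by rewrite le_eqVlt; apply/orP; left; apply/eqP; rewrite /a /b; ring.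
(* [(y C + z S)^2 <= y^2 + z^2] because [C^2 + S^2 = 1]; this makes the bound independent of [x]. *)
rewrite ler_pM2l ?pole_den_gt0// -sin_wave -cos_wave.
have := cos2Dsin2 (k.+1%:R * x); move: (cos _) (sin _) (a k) (b k) => C S y z CS.
have := sqr_ge0 (y * S - z * C).
have -> : y ^+ 2 + z ^+ 2 = (y ^+ 2 + z ^+ 2) * (C ^+ 2 + S ^+ 2) by rewrite CS mulr1.
by rewrite !expr2; nra.
Unshelve. all: by end_near. Qed.

End fourier_coefficients.

End energy.

(** * The inequality and its sharpness *)

Section sharpness.
Context {R : realType}.
Local Notation mu := (@lebesgue_measure R).
Local Notation P := (@period R).
Implicit Types (u g h phi : R -> R) (beta K l s : R) (a b : nat -> R) (k N : nat).
Local Notation "''I' f" := (\int[mu]_(x in P) f x) (at level 10, f at level 9).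

(** The norm at [+oo] is the essential supremum when the whole space has positive measure. *)
Lemma lebesgue_setT_gt0 : (0 < mu [set: R])%E.
Proof.
apply: (@lt_le_trans _ _ (mu `[0, 1])).
  by rewrite lebesgue_measure_itv/= lte_fin ltr01 oppr0 addr0 lte_fin.
by apply: le_measure; rewrite ?inE//; exact: measurable_itv.
Qed.

Lemma LinfE u : ('N[mu]_+oo[EFin \o u] = ess_sup mu (abse \o (EFin \o u)))%E.
Proof. by rewrite unlock /Lnorm lebesgue_setT_gt0. Qed.

Lemma Linf_le u (M : R) : 0 <= M -> {ae mu, forall x : R, `|u x| <= M} ->
  ('N[mu]_+oo[EFin \o u] ^+ 2 <= (M ^+ 2)%:E)%E.
Proof.
move=> M0 uM; have H : ('N[mu]_+oo[EFin \o u] <= M%:E)%E.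
  rewrite LinfE; apply/ess_supP; move: uM.
  by apply: (@filterS _ _ (ae_filter_ringOfSetsType mu)) => x /=; rewrite lee_fin.
by rewrite expe2 expr2 EFinM; apply: lee_pmul => //; exact: Lnorm_ge0.
Qed.

(** A continuous function exceeding a bound at one point exceeds it on an interval, which no null
    set contains. *)
Lemma Linf_ge h (x : R) : continuous h -> ((h x ^+ 2)%:E <= 'N[mu]_+oo[EFin \o h] ^+ 2)%E.
Proof.
move=> ch; suff H : (`|h x|%:E <= 'N[mu]_+oo[EFin \o h])%E.
  by rewrite -real_normK ?num_real// expr2 EFinM expe2; apply: lee_pmul.
have N0 := Lnorm_ge0 mu +oo (EFin \o h).
have [->|Noo] := eqVneq ('N[mu]_+oo[EFin \o h])%E +oo%E; first exact: leey.
have Nfin : ('N[mu]_+oo[EFin \o h])%E \is a fin_num by rewrite ge0_fin_numE// lt_neqAle Noo leey.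
rewrite -(fineK Nfin) lee_fin leNgt; apply/negP => Mx.
set M := fine _ in Mx.
have aeM : {ae mu, forall y : R, `|h y| <= M}.
  have := ess_sup_ge mu (abse \o (EFin \o h)); rewrite -LinfE -(fineK Nfin).
  by apply: (@filterS _ _ (ae_filter_ringOfSetsType mu)) => y /=; rewrite lee_fin.
have e0 : 0 < `|h x| - M by rewrite subr_gt0.
have /cvgrPdist_lt/(_ _ e0)[d /= d0 Hd] := ch x.
have xd : x < x + d by rewrite ltrDl.
have [z [/andP[xz zd] Hz]] := ae_itv_exists xd aeM.
have := Hd z; rewrite /= distrC ger0_norm; last by rewrite subr_ge0 ltW.
rewrite ltrBlDl => /(_ zd) H.
by have := ler_dist_dist (h x) (h z); have := ler_norm (`|h x| - `|h z|); lra.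
Qed.

(** The degenerate case of the inequality, where [lambda = A / B] is meaningless. *)
Lemma Linf_eq0 u g : H1dot_per u g -> 'I (fun x => u x ^+ 2) = 0 ->
  {ae mu, forall x : R, `|u x| <= 0}.
Proof.
move=> H I0; have [up [mu_ u2] _ _ _] := H.
apply: ae_periodic => [x|]; first by rewrite up.
have : (\int[mu]_(x in P) `|(u x ^+ 2)%:E| = 0)%E.
  rewrite -[RHS](_ : ('I (fun x => u x ^+ 2))%:E = 0%E); last by rewrite I0.
  rewrite fineK; last by apply: integrable_fin_num => //; exact: measurable_period.
  by apply: eq_integral => x _; rewrite gee0_abs// lee_fin sqr_ge0.
have mP := @measurable_period R.
move=> /(ae_eq_integral_abs _ mP (measurable_int _ u2)).1.
apply: (@filterS _ _ (ae_filter_ringOfSetsType mu)) => x /= Hx /andP[x0 x2]; have : P x by rewrite /period/= in_itv/= !ltW.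
by move=> /Hx[] /eqP; rewrite sqrf_eq0 => /eqP ->; rewrite normr0.
Qed.

Lemma pintegral_energy u g beta : square_integrable u -> square_integrable g ->
  'I (fun x => g x ^+ 2 - beta * u x ^+ 2) =
  'I (fun x => g x ^+ 2) - beta * 'I (fun x => u x ^+ 2).
Proof. by move=> [_ u2] [_ g2]; rewrite pintegralB ?pintegralZ//; exact: pintegrableZ. Qed.

(** Poincare's inequality and [beta < 1] make the energy [A] positive, so [l = A / B] is an
    admissible [lambda]. For it [A + l B = 2 A] and [sqrt l * sqrt A * sqrt B = A]. *)
Lemma interpolation_upper beta K : 0 <= beta < 1 -> ubound (sup_values beta) K ->
  interpolation_inequality beta K.
Proof.
move=> /andP[b0 b1] ub u g H; have [_ u2 g2 _ _] := H.
rewrite pintegral_energy//; set B := (X in _ * _ * Num.sqrt X).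
set A := (X in _ * Num.sqrt X * _).
have B0 : 0 <= B by apply: Rintegral_ge0 => x _; exact: sqr_ge0.
have AB : (1 - beta) * B <= A.
  by rewrite /A -/B mulrBl mul1r lerD2r; exact: H1_poincare H.
have [Bz|Bn] := eqVneq B 0.
  rewrite Bz sqrtr0 mulr0; have := Linf_le (lexx 0) (Linf_eq0 H Bz).
  by rewrite expr0n.
have Bp : 0 < B by rewrite lt_neqAle eq_sym Bn.
have Ap : 0 < A by apply: lt_le_trans AB; rewrite mulr_gt0// subr_gt0.
pose l := A / B.
have l0 : 0 < l by rewrite divr_gt0.
have s1 : -1 < l - beta by lra.
have := H1_sup H s1; rewrite -/B; set Q := (X in _ * pole_series _ * X).
have -> : Q = 2 * A.
  have -> : Q = A + l * B by rewrite /Q /A -/B; ring.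
  by rewrite /l divfK//; ring.
move=> /(Linf_le (sqrtr_ge0 _)) /le_trans; apply; rewrite lee_fin.
have F0 := pole_series_gt0 s1.
have p0 : 0 < (pi : R)^-1 by rewrite invr_gt0 pi_gt0.
rewrite sqr_sqrtr; last by rewrite !mulr_ge0// ltW.
have KF : Num.sqrt l * quotient (l - beta) <= K by apply: ub; exists l.
rewrite quotient_pole_series// in KF.
have X0 : 0 <= Num.sqrt A * Num.sqrt B by rewrite mulr_ge0 ?sqrtr_ge0.
have E : Num.sqrt l * (Num.sqrt A * Num.sqrt B) = A.
  rewrite mulrCA -sqrtrM ?(ltW l0)// /l divfK//.
  by rewrite -expr2 sqr_sqrtr// ltW.
rewrite -(mulrA K); apply: le_trans (ler_wpM2r X0 KF).
by rewrite [leRHS]mulrAC E le_eqVlt; apply/orP; left; apply/eqP; ring.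
Qed.

Lemma is_derive_trig_sum a b N (x : R) :
  is_derive x 1 (trig_sum a b N)
    (trig_sum (fun k => k.+1%:R * b k) (fun k => - (k.+1%:R * a k)) N x).
Proof.
elim: N => [|N IH].
  rewrite (_ : trig_sum a b 0 = cst 0); last by apply/funext => y; rewrite /trig_sum big_ord0.
  by rewrite /trig_sum big_ord0; exact: is_derive_cst.
have -> : trig_sum a b N.+1 = trig_sum a b N + (a N *: wave N.+1 0 + b N *: wave N.+1 (- (pi / 2))).
  by apply/funext => y; rewrite /trig_sum big_ord_recr.
have H := is_deriveD IH (is_deriveD (is_deriveZ (a N) (is_derive_wave N.+1 0 x))
  (is_deriveZ (b N) (is_derive_wave N.+1 (- (pi / 2)) x))).
apply: (@is_derive_eq _ _ _ _ _ _ _ _ H).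
rewrite /trig_sum big_ord_recr/= -!/(trig_sum _ _ N x); congr (_ + _).
rewrite /GRing.scale/= sinBpihalf addr0 -!sin_wave -!cos_wave.
ring.
Qed.

Lemma H1dot_trig_sum a b N : H1dot_per (trig_sum a b N)
  (trig_sum (fun k => k.+1%:R * b k) (fun k => - (k.+1%:R * a k)) N).
Proof.
split.
- exact: periodic_trig_sum.
- by apply: square_integrable_continuous; exact: continuous_trig_sum.
- by apply: square_integrable_continuous; exact: continuous_trig_sum.
- move=> phi [pp dp cp]; set v := trig_sum a b N; set w := trig_sum _ _ N.
  have cv : continuous v by exact: continuous_trig_sum.
  have cw : continuous w by exact: continuous_trig_sum.
  have cphi : continuous phi.
    by move=> x; apply: differentiable_continuous; apply/derivable1_diffP.
  have dphi (x : R) : is_derive x 1 phi (phi^`()%classic x).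
    by apply: DeriveDef => //; rewrite derive1E.
  apply/eqP; rewrite -addr_eq0 -pintegralD; first last.
  + by apply: pintegrableM => //; exact: pintegrable_continuous.
  + by apply: pintegrableM => //; exact: pintegrable_continuous.
  apply/eqP; transitivity (v (2 * pi) * phi (2 * pi) - v 0 * phi 0).
    apply: (@pintegral_FTC2 _ _ (fun x => v x * phi x)).
      by move=> x; apply: cvgD; apply: cvgM; [exact: cv|exact: cp|exact: cw|exact: cphi].
    move=> x; have H := is_deriveM (is_derive_trig_sum a b N x) (dphi x).
    apply: (@is_derive_eq _ _ _ _ _ _ _ _ H).
    by rewrite /GRing.scale/= -/v -/w; ring.
  have := pp 0; have := periodic_trig_sum a b N 0; rewrite -/v add0r => -> ->.
  by rewrite subrr.
- exact: pintegral_trig_sum.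
Qed.

(** For a Green partial sum with [u 0 = p], the inequality gives [p^2 <= K X] with
    [X = sqrt A * sqrt B], and AM-GM gives [2 sqrt l * X <= A + l B = pi p]. Eliminating [X] leaves
    [2 sqrt l * p / pi <= K]. *)
Lemma interpolation_lower beta K : beta < 1 -> interpolation_inequality beta K ->
  ubound (sup_values beta) K.
Proof.
move=> b1 HK _ [l /= l0 <-]; set s := l - beta.
have s1 : -1 < s by rewrite /s; lra.
rewrite quotient_pole_series//.
have H : (fun N => Num.sqrt l * (2 / pi * series (pole_term s) N)) @ \oo -->
    Num.sqrt l * (2 / pi * pole_series s).
  by apply: cvgM; [exact: cvg_cst|apply: cvgM; [exact: cvg_cst|exact: cvg_series_pole]].
apply: (cvgr_to_le H); exists 1%N => // N /= N1.
pose u := trig_sum (pole_term s) (fun=> 0) N.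
pose g := trig_sum (fun k => k.+1%:R * 0) (fun k => - (k.+1%:R * pole_term s k)) N.
have uH : H1dot_per u g by exact: H1dot_trig_sum.
have [_ u2 g2 _ _] := uH.
have := HK _ _ uH; rewrite pintegral_energy//; set B := (X in _ * _ * Num.sqrt X).
set A := (X in _ * Num.sqrt X * _).
set p := series (pole_term s) N.
have pE : p = \sum_(k < N) pole_term s k by rewrite /p /series/= big_mkord.
have p0 : 0 < p.
  apply: lt_le_trans (_ : series (pole_term s) 1 <= p); last exact: series_pole_nd.
  by rewrite seriesEnat/= big_nat1 pole_term_gt0.
have u0 : u 0 = p.
  by rewrite pE /u /trig_sum; apply: eq_bigr => k _; rewrite /wave mulr0 addr0 cos0; ring.
have BE : B = pi * \sum_(k < N) pole_term s k ^+ 2.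
  rewrite /B; under eq_Rintegral do rewrite expr2.
  by rewrite pintegral_trig_sumM; congr (_ * _); apply: eq_bigr => k _; ring.
have GE : 'I (fun x => g x ^+ 2) = pi * \sum_(k < N) k.+1%:R ^+ 2 * pole_term s k ^+ 2.
  under eq_Rintegral do rewrite expr2.
  by rewrite pintegral_trig_sumM; congr (_ * _); apply: eq_bigr => k _; ring.
have B0 : 0 <= B by apply: Rintegral_ge0 => x _; exact: sqr_ge0.
have A0 : 0 <= A.
  rewrite /A GE -/B BE mulrCA -mulrBr mulr_ge0 ?pi_ge0// mulr_sumr -sumrB.
  apply: sumr_ge0 => k _.
  by rewrite -mulrBl mulr_ge0 ?sqr_ge0// subr_ge0 (le_trans (ltW b1))// sqr_natS_ge.
(* The weight [k^2 + s] cancels one of the two factors [pole_term s]: the energy of a Green partial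
   sum is [pi] times its value at 0. *)
have ABE : A + l * B = pi * p.
  have -> : A + l * B = 'I (fun x => g x ^+ 2) + s * B by rewrite /A -/B /s; ring.
  rewrite GE BE pE mulrCA -mulrDr; congr (_ * _).
  rewrite mulr_sumr -big_split/=; apply: eq_bigr => k _.
  rewrite -mulrDl /pole_term; have := pole_den_gt0 k s1; move: (_ + s) => d d0.
  by field; rewrite gt_eqF.
have := Linf_ge 0 (@continuous_trig_sum R (pole_term s) (fun=> 0) N).
rewrite -/u u0 => /le_trans Hle /Hle; rewrite lee_fin -mulrA.
have : 2 * (Num.sqrt l * (Num.sqrt A * Num.sqrt B)) <= pi * p.
  rewrite -ABE -{2}(sqr_sqrtr A0) -{2}(sqr_sqrtr B0) -{2}(sqr_sqrtr (ltW l0)).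
  by have := sqr_ge0 (Num.sqrt A - Num.sqrt l * Num.sqrt B); rewrite !expr2; lra.
have : 0 <= Num.sqrt A * Num.sqrt B by rewrite mulr_ge0// sqrtr_ge0.
have := sqrtr_ge0 l; move: (Num.sqrt A * Num.sqrt B) (Num.sqrt l) => X t t0 X0 tX KX.
have K0 : 0 < K.
  rewrite ltNge; apply/negP => K0; have : K * X <= 0 by rewrite mulr_le0_ge0.
  by move=> /(le_trans KX); rewrite leNgt exprn_gt0.
have -> : t * (2 / pi * p) = (2 * t * p) / pi by ring.
rewrite ler_pdivrMr ?pi_gt0// -(ler_pM2r p0).
apply: (@le_trans _ _ (2 * t * (K * X))).
  by rewrite -(mulrA (2 * t)) -expr2 ler_wpM2l// mulr_ge0.
have -> : 2 * t * (K * X) = K * (2 * (t * X)) by ring.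
by rewrite -mulrA ler_wpM2l// ltW.
Qed.

Lemma sharp_constant_sup beta : 0 <= beta < 1 -> has_sup (sup_values beta) ->
  sharp_constant beta (sup (sup_values beta)).
Proof.
move=> b01 hs; split.
  by apply: interpolation_upper => //; exact: sup_upper_bound.
move=> K /= HK; apply: ge_sup; first by case: hs.
by apply: interpolation_lower => //; case/andP: b01.
Qed.

End sharpness.

(** * Rational bounds for the series and for pi *)

Section numeric.
Context {R : realType}.
Implicit Types (s t b l r : R) (k N : nat).

Lemma natr_add_half_gt0 k : 0 < k%:R + 2^-1 :> R.
Proof. by rewrite ltr_wpDl// invr_gt0. Qed.

Lemma natrS_add_half k : k.+1%:R = (k%:R + 2^-1) + 2^-1 :> R.
Proof. by rewrite -natr1 -addrA; congr (_ + _); field. Qed.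

(** At [s = -1/4] the denominator factors as [(k + 1/2) (k + 3/2)]. Since terms decrease in [s], the
    tail [1 / (N + 1/2)] is an upper bound for [s >= -1/4] and a lower bound for [s <= -1/4]. *)
Lemma telescope_half k : (k%:R + 2^-1)^-1 - (k.+1%:R + 2^-1)^-1 = pole_term (- (1 / 4) : R) k.
Proof.
rewrite /pole_term natrS_add_half; have := natr_add_half_gt0 k.
move: (k%:R + 2^-1) => x x0; field.
by do ?[apply/andP; split]; rewrite gt_eqF//; nra.
Qed.

Lemma pole_term_anti s t k : -1 < s -> s <= t -> pole_term t k <= pole_term s k.
Proof.
move=> s1 st; have t1 := lt_le_trans s1 st.
by rewrite /pole_term lef_pV2 ?posrE ?pole_den_gt0// lerD2l.
Qed.

Lemma pole_series_le_half s N : - (1 / 4) <= s ->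
  pole_series s <= series (pole_term s) N + (N%:R + 2^-1)^-1.
Proof.
move=> s4; apply: (@pole_series_le_telescope _ s (fun k => (k%:R + 2^-1)^-1)); first by lra.
  by move=> k; rewrite invr_ge0 ltW// natr_add_half_gt0.
by move=> k _; rewrite telescope_half; apply: pole_term_anti => //; lra.
Qed.

Lemma cvg_inv_add_half : (fun k => (k%:R + 2^-1 : R)^-1) @ \oo --> (0 : R).
Proof.
have H : (fun k => 2 * harmonic k : R) @ \oo --> (0 : R).
  by rewrite -[X in _ --> X](mulr0 2); apply: cvgM; [exact: cvg_cst|exact: cvg_harmonic].
apply: (squeeze_cvgr _ (cvg_cst 0) H).
near=> k; rewrite invr_ge0 ltW ?natr_add_half_gt0//= -[2 * _]invrK lef_pV2 ?posrE ?natr_add_half_gt0 ?invr_gt0 ?mulr_gt0//.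
by rewrite invfM invrK -[k.+1%:R]natr1; have : 0 <= k%:R :> R by []; lra.
Unshelve. all: by end_near. Qed.

Lemma pole_series_ge_half s N : -1 < s -> s <= - (1 / 4) ->
  series (pole_term s) N + (N%:R + 2^-1)^-1 <= pole_series s.
Proof.
move=> s1 s4; apply: (@pole_series_ge_telescope _ s (fun k => (k%:R + 2^-1)^-1)) => //.
  exact: cvg_inv_add_half.
by move=> k _; rewrite telescope_half; apply: pole_term_anti => //; lra.
Qed.

(* [3 x / (3 x ^ 2 + s + 1/4)] is the rational tail whose telescoped
   difference agrees with [1 / (k ^ 2 + s)] up to order [k ^ -6], with an
   error of the sign of [4 s + 1]. *)
Definition tail s k : R := 3 * (k%:R + 2^-1) / (3 * (k%:R + 2^-1) ^+ 2 + (s + 1 / 4)).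

Lemma tail_den_gt0 s k : -1 < s -> 0 < 3 * (k%:R + 2^-1) ^+ 2 + (s + 1 / 4).
Proof.
move=> s1; have : 2^-1 <= k%:R + 2^-1 :> R by rewrite lerDr.
by move: (k%:R + 2^-1) => x x2; have : 2^-1 * 2^-1 <= x * x by [nra]; rewrite expr2; lra.
Qed.

Lemma tail_ge0 s k : -1 < s -> 0 <= tail s k.
Proof.
by move=> s1; rewrite /tail divr_ge0//; rewrite ltW// tail_den_gt0.
Qed.

Lemma tail_diff s k : -1 < s ->
  tail s k - tail s k.+1 - pole_term s k =
  - (1 + s) * (4 * s + 1) / ((k.+1%:R ^+ 2 + s) *
   ((3 * (k%:R + 2^-1) ^+ 2 + (s + 1 / 4)) * (3 * (k.+1%:R + 2^-1) ^+ 2 + (s + 1 / 4)))).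
Proof.
move=> s1; rewrite /tail /pole_term.
have := tail_den_gt0 k s1; have := tail_den_gt0 k.+1 s1; have := pole_den_gt0 k s1.
rewrite -[k.+1%:R]natr1; move: (k%:R : R) => x d1 d2 d3.
by field; do ?[apply/andP; split]; rewrite gt_eqF//; lra.
Qed.

(** Supplies the upper bound on the side where [1 / (N + 1/2)] is only a lower bound. *)
Lemma pole_series_le_tail s N : -1 < s -> s <= - (1 / 4) ->
  pole_series s <= series (pole_term s) N + tail s N.
Proof.
move=> s1 s4; apply: pole_series_le_telescope => // [k|k _]; first exact: tail_ge0.
rewrite -subr_ge0 tail_diff// divr_ge0//; first by nra.
by rewrite !mulr_ge0// ltW// ?pole_den_gt0 ?tail_den_gt0.
Qed.

Lemma pole_series_ge_tail s N : - (1 / 4) <= s ->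
  series (pole_term s) N + tail s N <= pole_series s.
Proof.
move=> s4; have s1 : -1 < s by lra.
apply: pole_series_ge_telescope => // [|k _].
  apply: (squeeze_cvgr _ (cvg_cst 0) cvg_inv_add_half); near=> k.
  rewrite tail_ge0//= /tail ler_pdivrMr ?tail_den_gt0// -ler_pdivrMl ?invr_gt0 ?natr_add_half_gt0//.
  by rewrite invrK; have := natr_add_half_gt0 k; rewrite expr2; lra.
rewrite -subr_le0 tail_diff// mulNr mulNr oppr_le0 divr_ge0//; first by nra.
by rewrite !mulr_ge0// ltW// ?pole_den_gt0 ?tail_den_gt0.
Unshelve. all: by end_near. Qed.

(* The quotient formula at [s = - 1/16], where [cot (pi / 4) = 1]. *)
Lemma pi_pole_series : pi = 4 - pole_series (- (1 / 16)) / 2 :> R.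
Proof.
have s1 : -1 < - (1 / 16) :> R by lra.
have s0 : - (1 / 16) < 0 :> R by lra.
have := quotient0_lt0 s1 s0; rewrite /quotient0 /sqrt_coth ltNge ltW//= opprK.
have -> : Num.sqrt (1 / 16 : R) = 1 / 4.
  have -> : 1 / 16 = (1 / 4) ^+ 2 :> R by field.
  by rewrite sqrtr_sqr ger0_norm// divr_ge0.
have -> : cot (pi * (1 / 4)) = 1 :> R.
  have := @tan_piquarter R; rewrite /tan /cot mulrA mulr1 => H.
  by rewrite -[LHS]invrK invf_div H invr1.
have := @pi_neq0 R; move: (pi : R) (pole_series _) => p F p0 H.
have : (1 / 4 * 1 - p^-1) / - (1 / 16) * p = 2 * F.
  by rewrite H; field.
have -> : (1 / 4 * 1 - p^-1) / - (1 / 16) * p = 16 - 4 * p by field.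
lra.
Qed.

(** An upper bound on the series bounds [pi] from below; seven terms make the crude tail accurate
    enough. For the bound from above, the refined tail does with two terms. *)
Lemma pi_gt : 3141 / 1000 < pi :> R.
Proof.
rewrite pi_pole_series; have := @pole_series_le_half (- (1 / 16)) 7 _.
have -> : - (1 / 4) <= - (1 / 16) :> R by lra.
move=> /(_ isT).
have -> : series (pole_term (- (1 / 16) : R)) 7 + (7%:R + 2^-1)^-1 =
    16 / 15 + 16 / 63 + 16 / 143 + 16 / 255 + 16 / 399 + 16 / 575 + 16 / 783 + 2 / 15.
  by rewrite /series/= !big_nat_recr//= big_geq// /pole_term; field.
lra.
Qed.

Lemma pi_lt : pi < 3142 / 1000 :> R.
Proof.
rewrite pi_pole_series; have := @pole_series_ge_tail (- (1 / 16)) 2 _.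
have -> : - (1 / 4) <= - (1 / 16) :> R by lra.
move=> /(_ isT).
have -> : series (pole_term (- (1 / 16) : R)) 2 + tail (- (1 / 16)) 2 =
    16 / 15 + 16 / 63 + 40 / 101.
  by rewrite /series/= !big_nat_recr//= big_geq// /pole_term /tail; field.
lra.
Qed.

Lemma quotient_839_small t s : 0 <= t -> s = t ^+ 2 - 839 / 1000 -> -1 < s -> s <= - (1 / 4) ->
  t * (2 / pi * pole_series s) <= 1.
Proof.
move=> t0 st s1 s4; have := pole_series_le_tail 1 s1 s4.
have -> : series (pole_term s) 1%N + tail s 1 = (7 + s + 9 / 2 * (1 + s)) / ((1 + s) * (7 + s)).
  rewrite /series/= big_nat1 /pole_term /tail.
  by field; do ?[apply/andP; split]; rewrite gt_eqF//; lra.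
have d0 : 0 < (1 + s) * (7 + s) by apply: mulr_gt0; lra.
rewrite ler_pdivlMr// => H.
have -> : t * (2 / pi * pole_series s) = (2 * t * pole_series s) / pi by ring.
rewrite ler_pdivrMr ?pi_gt0// mul1r ltW// (le_lt_trans _ pi_gt)//.
rewrite -(ler_pM2r d0); apply: le_trans (_ : 2 * t * (7 + s + 9 / 2 * (1 + s)) <= _).
  by rewrite -(mulrA (2 * t)) ler_wpM2l// mulr_ge0.
(* The remaining inequality is quartic in [t]. The first square absorbs its terms in [t^4] and
   [t^3]; the second is centred near the minimum of the quadratic left over, where the inequality is
   nearly tight. *)
rewrite st; have := sqr_ge0 (3141 / 1000 * t ^+ 2 - 11 / 2 * t + 2045 / 1000).
by have := sqr_ge0 (t - 538 / 1000); lra.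
Qed.

Lemma quotient_839_middle t s : 3 / 4 <= t -> t <= 61 / 40 -> s = t ^+ 2 - 839 / 1000 -> - (1 / 4) <= s ->
  t * (2 / pi * pole_series s) <= 1.
Proof.
move=> t0 t1 st s4; have := pole_series_le_half 2 s4.
have -> : series (pole_term s) 2 + (2%:R + 2^-1)^-1 =
    (5 + 2 * s + 2 / 5 * ((1 + s) * (4 + s))) / ((1 + s) * (4 + s)).
  rewrite /series/= !big_nat_recr//= big_geq// /pole_term.
  by field; do ?[apply/andP; split]; rewrite gt_eqF//; lra.
have d0 : 0 < (1 + s) * (4 + s) by apply: mulr_gt0; lra.
rewrite ler_pdivlMr// => H.
have -> : t * (2 / pi * pole_series s) = (2 * t * pole_series s) / pi by ring.
rewrite ler_pdivrMr ?pi_gt0// mul1r ltW// (le_lt_trans _ pi_gt)//.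
rewrite -(ler_pM2r d0).
apply: le_trans (_ : 2 * t * (5 + 2 * s + 2 / 5 * ((1 + s) * (4 + s))) <= _).
  by rewrite -(mulrA (2 * t)) ler_wpM2l//; lra.
rewrite st.
have y0 : 0 <= t - 3 / 4 by lra.
have z0 : 0 <= 61 / 40 - t by lra.
(* For [i + j = 5] these are, up to scaling, the Bernstein polynomials on [[3/4, 61/40]], matching
   the degree 5 of the inequality in [t]. *)
have h i j : 0 <= (t - 3 / 4) ^+ i * (61 / 40 - t) ^+ j by rewrite mulr_ge0// exprn_ge0.
have := h 0%N 5; have := h 1%N 4; have := h 2 3; have := h 3 2; have := h 4 1%N; have := h 5 0%N.
by rewrite !expr0 !expr1; lra.
Qed.

End numeric.

(** * Bounds from the closed form and the values near the threshold *)

Section quotient_bounds.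
Context {R : realType}.
Implicit Types (s t b l r x : R).

Lemma coth_eq x : 0 < x -> coth x = 1 + 2 / (expR (2 * x) - 1).
Proof.
move=> x0; have e1 : 1 < expR x by rewrite expR_gt1.
have -> : expR (2 * x) = expR x ^+ 2 by rewrite -expRM_natl.
rewrite /coth expRN; move: (expR x) e1 => e e1.
have e2 : e ^+ 2 - 1 != 0 by rewrite subr_eq0 gt_eqF// expr_gt1// ltW// (lt_trans _ e1).
have e0 : e != 0 by rewrite gt_eqF// (lt_trans _ e1).
have e3 : e - e^-1 != 0.
  have -> : e - e^-1 = (e ^+ 2 - 1) / e by field.
  by rewrite mulf_neq0// invr_neq0.
apply: (mulIf e3); rewrite divfK//.
have -> : e - e^-1 = (e ^+ 2 - 1) / e by field.
by field; rewrite e0 e2.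
Qed.

Lemma coth_ge1 x : 0 < x -> 1 <= coth x.
Proof.
move=> x0; rewrite coth_eq// lerDl divr_ge0// subr_ge0 ltW// expR_gt1.
by rewrite mulr_gt0.
Qed.

Lemma coth_le x : 0 < x -> coth x <= 1 + x^-1.
Proof.
move=> x0; rewrite coth_eq// lerD2l.
have E : 2 * x <= expR (2 * x) - 1 by have := expR_ge1Dx (2 * x); lra.
rewrite ler_pdivrMr; last by apply: lt_le_trans E; rewrite mulr_gt0.
by rewrite -ler_pdivrMl ?invr_gt0// invrK mulrC.
Qed.

Lemma quotient_pos s : 0 < s ->
  quotient s = (Num.sqrt s * coth (pi * Num.sqrt s) - pi^-1) / s.
Proof. by move=> s0; rewrite /quotient gt_eqF// /quotient0 /sqrt_coth s0. Qed.

(** In the bound [1 + 1 / x] for coth, the part [1 / x] contributes exactly the [1 / pi] that the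
    quotient subtracts. *)
Lemma quotient_le s : 0 < s -> quotient s <= (Num.sqrt s)^-1.
Proof.
move=> s0; rewrite quotient_pos//; have r0 : 0 < Num.sqrt s by rewrite sqrtr_gt0.
have rs : Num.sqrt s ^+ 2 = s by rewrite sqr_sqrtr// ltW.
rewrite -[X in _ / X <= _]rs; move: (Num.sqrt s) r0 {rs} => r r0.
have := coth_le (mulr_gt0 (pi_gt0 R) r0); move: (coth _) => c Hc.
rewrite ler_pdivrMr ?exprn_gt0// expr2 mulKf ?gt_eqF// lerBlDr.
apply: le_trans (ler_wpM2l (ltW r0) Hc) _.
rewrite mulrDr mulr1 invfM mulrCA divff ?gt_eqF// mulr1.
by [].
Qed.

Lemma quotient_ge s : 0 < s -> (Num.sqrt s - pi^-1) / s <= quotient s.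
Proof.
move=> s0; rewrite quotient_pos//.
have r0 : 0 < Num.sqrt s by rewrite sqrtr_gt0.
apply: ler_wpM2r; first by rewrite invr_ge0 ltW.
by rewrite lerD2r ler_peMr ?(ltW r0)// coth_ge1// mulr_gt0// pi_gt0.
Qed.

(** The fourth power of [1 + x <= exp x] at [x = pi r / 2], with [157/100 < pi / 2]; the cubic and
    quartic terms are lowered by means of [r >= 12/10]. *)
Lemma expR_2pi_ge r : 12 / 10 <= r -> 29 * r ^+ 2 + 13 <= expR (2 * (pi * r)) - 1.
Proof.
move=> r1; have -> : 2 * (pi * r) = 4%:R * (pi * r / 2) by field.
rewrite expRM_natl.
have z : 1 + 157 / 100 * r <= expR (pi * r / 2).
  apply: le_trans (expR_ge1Dx _); rewrite lerD2l.
  have := @pi_gt R; nra.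
have z0 : 0 <= 1 + 157 / 100 * r by lra.
have : (1 + 157 / 100 * r) ^+ 4 <= expR (pi * r / 2) ^+ 4.
  by rewrite lerXn2r// nnegrE// expR_ge0.
move: (expR _ ^+ 4) => E HE.
have r2 : 12 / 10 * r <= r ^+ 2 by rewrite expr2; nra.
have r3 : 12 / 10 * r ^+ 2 <= r ^+ 3 by rewrite exprS ler_wpM2r// sqr_ge0.
have r4 : 12 / 10 * r ^+ 3 <= r ^+ 4.
  by rewrite [r ^+ 4]exprS ler_wpM2r// exprn_ge0//; lra.
lra.
Qed.

Lemma pi_inv_bounds : 318 / 1000 <= (pi : R)^-1 <= 1.
Proof.
rewrite -[pi^-1]div1r ler_pdivlMr ?ler_pdivrMr ?pi_gt0//.
by apply/andP; have := @pi_lt R; have := @pi_ge2 R; split; lra.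
Qed.

Lemma quotient_839_large t s : 61 / 40 <= t -> s = t ^+ 2 - 839 / 1000 -> t * quotient s <= 1.
Proof.
move=> t1 st; have s1 : 144 / 100 <= s by rewrite st expr2; nra.
have s0 : 0 < s by lra.
rewrite quotient_pos//.
have rs : Num.sqrt s ^+ 2 = s by rewrite sqr_sqrtr// ltW.
have r0 : 0 < Num.sqrt s by rewrite sqrtr_gt0.
have r1 : 12 / 10 <= Num.sqrt s.
  by rewrite leNgt; apply/negP => r12; have : Num.sqrt s ^+ 2 < 144 / 100 by [rewrite expr2; nra]; lra.
have [r [{}rs {}r0 {}r1 ->]] : exists r : R, [/\ r ^+ 2 = s, 0 < r, 12 / 10 <= r & Num.sqrt s = r].
  by exists (Num.sqrt s).
rewrite coth_eq ?mulr_gt0 ?pi_gt0//.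
have := expR_2pi_ge r1; move: (expR _ - 1) => E HE.
have E0 : 0 < E by apply: lt_le_trans HE; have := sqr_ge0 r; lra.
have t0 : 0 <= t by lra.
have q0 := sqr_ge0 r.
(* [42/100] is just above half of [839/1000], so [(r^2 + 42/100)^2] dominates
   [r^2 (r^2 + 839/1000) = (t r)^2]. *)
have tr : t * r <= r ^+ 2 + 42 / 100.
  have q1 : 0 <= r ^+ 2 + 42 / 100 by lra.
  rewrite -ler_sqr ?nnegrE ?mulr_ge0 ?(ltW r0)//.
  rewrite exprMn (_ : t ^+ 2 = r ^+ 2 + 839 / 1000); last by rewrite rs st; ring.
  by move: (r ^+ 2) q0 => q q0; rewrite sqrrD expr2 mulrDl; lra.
have /andP[p1 p2] := pi_inv_bounds.
rewrite -rs mulrA ler_pdivrMr ?exprn_gt0// mul1r.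
move: (pi^-1) p1 p2 => p p1 p2.
have D0 : 0 <= 2 / E by rewrite divr_ge0// ltW.
(* The lower bound [29 r^2 + 13] on [E] is made for this: [2 (r^2 + 0.42) <= 0.07 (29 r^2 + 13)].
   The final balance is [0.42 + 0.07 <= 0.318 * 1.55]. *)
have D1 : (r ^+ 2 + 42 / 100) * (2 / E) <= 7 / 100.
  rewrite mulrA ler_pdivrMr//; lra.
move: (2 / E) D0 D1 => d D0 D1.
have -> : t * (r * (1 + d) - p) = (t * r) * (1 + d - p / r) by field; rewrite gt_eqF.
have pr : p / r <= 1 by rewrite ler_pdivrMr// mul1r; lra.
apply: le_trans (_ : (r ^+ 2 + 42 / 100) * (1 + d - p / r) <= _).
  by rewrite ler_wpM2r//; lra.
have -> : (r ^+ 2 + 42 / 100) * (1 + d - p / r) =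
   r ^+ 2 + 42 / 100 + (r ^+ 2 + 42 / 100) * d - p * (r + 42 / 100 / r).
  by field; rewrite gt_eqF.
have q1 : 155 / 100 <= r + 42 / 100 / r.
  have -> : r + 42 / 100 / r = (r ^+ 2 + 42 / 100) / r by field; rewrite gt_eqF.
  by rewrite ler_pdivlMr// expr2; nra.
by move: (r + _ / r) q1 => q q1; nra.
Qed.

Lemma sup_values_839_le1 l : 0 < l -> Num.sqrt l * quotient (l - 839 / 1000) <= 1.
Proof.
move=> l0; set t := Num.sqrt l; have t0 : 0 < t by rewrite sqrtr_gt0.
have lt : l = t ^+ 2 by rewrite sqr_sqrtr// ltW.
have s1 : -1 < l - 839 / 1000 by lra.
have [t1|t1] := leP (61 / 40) t; first by apply: quotient_839_large => //; rewrite lt.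
rewrite quotient_pole_series//; have [s4|s4] := leP (l - 839 / 1000) (- (1 / 4)).
  by apply: (quotient_839_small (ltW t0)) => //; rewrite lt.
apply: quotient_839_middle => //; [|exact: ltW|by rewrite lt|exact: ltW].
by rewrite leNgt; apply/negP => t3; have : l < 9 / 16 by [rewrite lt expr2; nra]; lra.
Qed.

Lemma sup_values_84_gt1 : exists2 l : R, 0 < l & 1 < Num.sqrt l * quotient (l - 84 / 100).
Proof.
(* A near-maximizer for which [lambda - 84/100 = - 5/9] is a simple fraction. *)
exists ((8 / 15) ^+ 2); first by rewrite exprn_gt0.
rewrite sqrtr_sqr ger0_norm//.
have -> : (8 / 15) ^+ 2 - 84 / 100 = - (5 / 9) :> R by field.
rewrite quotient_pole_series; last by lra.
have : series (pole_term (- (5 / 9) : R)) 5 + (5%:R + 2^-1)^-1 <= pole_series (- (5 / 9)).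
  by apply: pole_series_ge_half; lra.
have -> : series (pole_term (- (5 / 9) : R)) 5 + (5%:R + 2^-1)^-1 =
    9 / 4 + 9 / 31 + 9 / 76 + 9 / 139 + 9 / 220 + 2 / 11.
  by rewrite /series/= !big_nat_recr//= big_geq// /pole_term; field.
have -> : 8 / 15 * (2 / pi * pole_series (- (5 / 9))) = (16 / 15 * pole_series (- (5 / 9))) / pi :> R.
  by have := @pi_neq0 R; move: (pi : R) => p p0; field.
rewrite ltr_pdivlMr ?pi_gt0// mul1r => H; apply: lt_trans (@pi_lt R) _.
lra.
Qed.

(** * The supremum and the threshold set *)

Section beta.
Variable b : R.
Hypothesis b01 : 0 <= b < 1.

Lemma sup_values_nonempty : sup_values b !=set0.
Proof. by exists (Num.sqrt 1 * quotient (1 - b)); exists 1 => //=. Qed.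

(** For [l >= 2] the values are at most [sqrt (l / (l - b)) <= 2]; for [l < 2] the series is at most
    its value at [- b], finite because [b < 1]. *)
Lemma has_sup_sup_values : has_sup (sup_values b).
Proof.
split; first exact: sup_values_nonempty.
have /andP[b0 b1] := b01.
have F0 : 0 <= 2 / pi * pole_series (- b).
  by rewrite mulr_ge0 ?divr_ge0 ?pi_ge0// ltW// pole_series_gt0//; lra.
exists (2 + 2 * (2 / pi * pole_series (- b))) => _ [l /= l0 <-].
have [l2|l2] := leP 2 l.
  have s0 : 0 < l - b by lra.
  have r0 : 0 < Num.sqrt (l - b) by rewrite sqrtr_gt0.
  apply: (@le_trans _ _ 2); last by lra.
  apply: le_trans (ler_wpM2l (sqrtr_ge0 l) (quotient_le s0)) _.
  rewrite ler_pdivrMr// -ler_sqr ?nnegrE ?sqrtr_ge0 ?mulr_ge0 ?sqrtr_ge0//.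
  by rewrite exprMn !sqr_sqrtr ?ltW// expr2; lra.
apply: (@le_trans _ _ (2 * (2 / pi * pole_series (- b)))); last by lra.
rewrite quotient_pole_series; last by lra.
apply: ler_pM.
- exact: sqrtr_ge0.
- by rewrite mulr_ge0 ?divr_ge0 ?pi_ge0// ltW// pole_series_gt0//; lra.
- rewrite -ler_sqr ?nnegrE ?sqrtr_ge0// sqr_sqrtr ?ltW// expr2; lra.
- by rewrite ler_wpM2l ?divr_ge0 ?pi_ge0// pole_series_anti//; lra.
Qed.

(** At [l = r^2 + b] the value is at least [1 - 1 / (pi r)], which tends to 1 as [r] grows;
    [r = 1 / e + 1] brings it within [e]. *)
Lemma sup_values_ge1 : 1 <= sup (sup_values b).
Proof.
have /andP[b0 b1] := b01.
apply/ler_addgt0Pr => e e0; rewrite -lerBlDr.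
pose r := e^-1 + 1.
have r0 : 0 < r by rewrite /r ltr_wpDl// invr_ge0 ltW.
pose l := r ^+ 2 + b.
have l0 : 0 < l by rewrite /l ltr_pwDl// exprn_gt0.
apply: (@le_trans _ _ (Num.sqrt l * quotient (l - b))); last first.
  by apply: sup_upper_bound; [exact: has_sup_sup_values|exists l].
have lb : l - b = r ^+ 2 by rewrite /l addrK.
have s0 : 0 < l - b by rewrite lb exprn_gt0.
have rl : r <= Num.sqrt l.
  by rewrite -ler_sqr ?nnegrE ?sqrtr_ge0 ?(ltW r0)// sqr_sqrtr ?(ltW l0)// /l lerDl.
have p0 : 0 < (pi : R)^-1 by rewrite invr_gt0 pi_gt0.
have /andP[_ p1] := pi_inv_bounds.
have := quotient_ge s0; rewrite lb sqrtr_sqr ger0_norm ?(ltW r0)// => H.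
have r1 : 1 <= r by rewrite /r lerDr invr_ge0 ltW.
apply: (@le_trans _ _ (r * ((r - pi^-1) / r ^+ 2))); last first.
  apply: ler_pM => //; first exact: ltW.
  by rewrite divr_ge0 ?sqr_ge0//; lra.
have -> : r * ((r - pi^-1) / r ^+ 2) = 1 - pi^-1 / r.
  by move: (pi^-1) => p; field; rewrite gt_eqF.
rewrite lerD2l lerN2 ler_pdivrMr//.
apply: le_trans p1 _; rewrite /r mulrDr mulfV ?gt_eqF// mulr1; lra.
Qed.

(** As the supremum is never below 1, equality with 1 amounts to an upper bound. *)
Lemma thresholdE : threshold b <-> ubound (sup_values b) 1.
Proof.
split=> [[_ <-]|ub]; first exact/sup_upper_bound/has_sup_sup_values.
split => //; apply/eqP; rewrite eq_le sup_values_ge1 andbT.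
by apply: ge_sup => //; exact: sup_values_nonempty.
Qed.

End beta.

Lemma threshold_down b b' : threshold b -> 0 <= b' -> b' <= b -> threshold b'.
Proof.
move=> tb b0' bb; have [b01 _] := tb; have /andP[b0 b1] := b01.
apply/thresholdE; first by rewrite b0' (le_lt_trans bb).
move=> _ [l /= l0 <-]; have ub := (thresholdE b01).1 tb.
apply: le_trans (ub _ _); last by exists l.
rewrite ler_wpM2l ?sqrtr_ge0// !quotient_pole_series; [|lra..].
by rewrite ler_wpM2l ?divr_ge0 ?pi_ge0// pole_series_anti//; lra.
Qed.

Lemma threshold_839 : threshold (839 / 1000 : R).
Proof.
apply/thresholdE; first by apply/andP; split; lra.
by move=> _ [l /= l0 <-]; exact: sup_values_839_le1.
Qed.

Lemma threshold_lt b : threshold b -> b < 84 / 100.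
Proof.
move=> tb; rewrite ltNge; apply/negP => b84.
have t84 : threshold (84 / 100 : R) by apply: threshold_down tb _ b84; lra.
have [l l0] := sup_values_84_gt1; rewrite ltNge => /negP; apply.
have [b01 _] := t84; apply: ((thresholdE b01).1 t84); by exists l.
Qed.

Lemma threshold_has_sup : has_sup (@threshold R).
Proof.
split; first by exists (839 / 1000); exact: threshold_839.
by exists (84 / 100) => b /threshold_lt/ltW.
Qed.

(** The factor [1 + l - beta] provides the continuity in [beta]: for [b] in the threshold set within
    [e] of its supremum [b2], the value [V] at [b2] satisfies [(1 + l - b2) V <= 1 + l - b <= 1 + l
    - b2 + e], and [e] is arbitrary. *)
Lemma threshold_sup : threshold (sup (@threshold R)).
Proof.
set b2 := sup _; have hs := threshold_has_sup.
have b2ge : 839 / 1000 <= b2 by apply: sup_upper_bound => //; exact: threshold_839.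
have b2le : b2 <= 84 / 100.
  by apply: ge_sup; [case: hs|move=> b /threshold_lt/ltW].
have b201 : 0 <= b2 < 1 by apply/andP; split; lra.
apply/(thresholdE b201) => _ [l /= l0 <-].
rewrite quotient_pole_series; last by lra.
set V := Num.sqrt l * _; have s1 : 0 < 1 + (l - b2) by lra.
rewrite -(ler_pM2l s1) mulr1; apply/ler_addgt0Pr => e e0.
have [b tb bb2] := sup_adherent e0 hs.
have bb : b <= b2 by apply: sup_upper_bound.
have [b01 _] := tb.
have : Num.sqrt l * quotient (l - b) <= 1 by apply: ((thresholdE b01).1 tb); exists l.
rewrite quotient_pole_series; last by lra.
set V' := Num.sqrt l * _ => V'1.
have : (1 + (l - b2)) * V <= (1 + (l - b)) * V'.
  rewrite /V /V' [leLHS]mulrCA [leRHS]mulrCA ler_wpM2l ?sqrtr_ge0//.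
  rewrite [leLHS]mulrCA [leRHS]mulrCA ler_wpM2l ?divr_ge0 ?pi_ge0//.
  by apply: pole_series_mul_nd; lra.
have : (1 + (l - b)) * V' <= 1 + (l - b) by rewrite ler_piMr//; lra.
by rewrite -/b2 in bb2; lra.
Qed.

End quotient_bounds.

Theorem theorem2p2 (R : realType) :
  (forall beta : R, 0 <= beta < 1 ->
     has_sup (sup_values beta) /\
     sharp_constant beta (sup (sup_values beta))) /\
  (exists beta2 : R,
     [/\ threshold beta2,
         ubound threshold beta2,
         839%:R / 1000%:R <= beta2 < 840%:R / 1000%:R
       & forall beta : R, 0 <= beta <= beta2 -> sharp_constant beta 1]).
Proof.
split=> [beta b01|].
  by have hs := has_sup_sup_values b01; split => //; exact: sharp_constant_sup.
exists (sup threshold); have tb := @threshold_sup R; split => //.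
- exact/sup_upper_bound/threshold_has_sup.
- apply/andP; split; last by have := threshold_lt tb; lra.
  by apply: sup_upper_bound; [exact: threshold_has_sup|exact: threshold_839].
- move=> beta /andP[b0 bb]; have [b01 <-] := threshold_down tb b0 bb.
  by apply: sharp_constant_sup => //; exact: has_sup_sup_values.
Qed.
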